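(* Let $\Bbbk$ be a field of any characteristic. A dg algebra $B$ over $\Bbbk$ is a monoid with respect to the twisted tensor product $\tilde\otimes$ sharing the dg algebra unit if and only if it is an algebra over the braces operad $\mathbf{Br}$ of Getzler–Jones whose underlying differential on the tensor coalgebra $T_+^\vee(B[1])$ is given by the bar-differential of the underlying dg algebra $B$.
   Context: **Coherent internal Hom.** $\mathrm{Cat}_{dg}(\Bbbk)$ is the category of small dg categories over $\Bbbk$; a dg algebra (with unit $1_B$) is regarded as a dg category with one object. For $D,E\in\mathrm{Cat}_{dg}(\Bbbk)$, the dg category $[D,E]$ has dg functors $D\to E$ as objects and $[D,E](F,G)=\mathrm{Hoch}^\bullet(D,M_{F,G})$, where $M_{F,G}(d_0,d_1)=E(F(d_0),G(d_1))$ and $\mathrm{Hoch}^\bullet(D,M)$ is the reduced cohomological Hochschild complex: the product-total complex of cochains in $\prod_{d_0,\dots,d_\ell}\underline{\mathrm{Hom}}_\Bbbk(D(d_{\ell-1},d_\ell)\otimes\dots\otimes D(d_0,d_1),M(d_0,d_\ell))$ vanishing when some argument is an identity, with the usual Hochschild differential. Composition is the cup product. **Twisted tensor product.** $C\tilde\otimes D$ is the value on $C$ of the left adjoint to $[D,-]$: $\mathrm{Hom}(C\tilde\otimes D,E)\simeq\mathrm{Hom}(C,[D,E])$. Explicitly, its objects are $\mathrm{Ob}(C)\times\mathrm{Ob}(D)$; its morphisms are generated under composition $\star$ by $f\otimes\mathrm{id}_d$ ($f\in\mathrm{Mor}\,C$), $\mathrm{id}_c\otimes g$ ($g\in\mathrm{Mor}\,D$),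 and, for $f:c_0\to c_1$ in $C$ and a chain $d_0\xrightarrow{g_1}\cdots\xrightarrow{g_n}d_n$ in $D$ with $n\ge1$, new morphisms $\varepsilon(f;g_1,\dots,g_n):(c_0,d_0)\to(c_1,d_n)$ of degree $-n+\deg f+\sum\deg g_j$. The relations are: (R1) $(\mathrm{id}_c\otimes g_1)\star(\mathrm{id}_c\otimes g_2)=\mathrm{id}_c\otimes g_1g_2$ and $(f_1\otimes\mathrm{id}_d)\star(f_2\otimes\mathrm{id}_d)=f_1f_2\otimes\mathrm{id}_d$; (R2) $\varepsilon$ is linear in each argument; (R3) $\varepsilon(f;g_1,\dots,g_n)=0$ if some $g_i$ is an identity, or if $f$ is an identity and $n\ge1$; (R4) $\varepsilon(f_2f_1;g_1,\dots,g_N)=\sum_{0\le m\le N}(-1)^{|f_1|(\sum_{j>m}|g_j|+N-m)}\varepsilon(f_2;g_{m+1},\dots,g_N)\star\varepsilon(f_1;g_1,\dots,g_m)$, where $\varepsilon(f;\,)$ with no further arguments means $f\otimes\mathrm{id}$. The differential extends those of $C$ and $D$, with $[d,\varepsilon(f;g)]=\pm(\mathrm{id}\otimes g)\star(f\otimes\mathrm{id})\pm(f\otimes\mathrm{id})\star(\mathrm{id}\otimes g)$ and, for $n\ge2$, $[d,\varepsilon(f;g_1,\dots,g_n)]=\pm(\mathrm{id}\otimes g_n)\star\varepsilon(f;g_1,\dots,g_{n-1})\pm\varepsilon(f;g_2,\dots,g_n)\star(\mathrm{id}\otimes g_1)+\sum_i\pm\varepsilon(f;g_1,\dots,g_{i+1}g_i,\dots,g_n)$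 (for closed $f,g_j$, otherwise plus the terms coming from their differentials). The signs are the Hochschild signs: under the adjunction a dg functor $\Phi:C\tilde\otimes D\to E$ corresponds to $c\mapsto\Phi(\mathrm{id}_c\otimes-)$, $f\mapsto$ the cochain with components $\Phi(f\otimes\mathrm{id}_d)$ and $(g_1,\dots,g_n)\mapsto\Phi(\varepsilon(f;g_1,\dots,g_n))$, up to conventional signs. With unit $\underline{\Bbbk}$ (one object, endomorphisms $\Bbbk$; the unit is strict), $\tilde\otimes$ is a skew-monoidal structure: there is a natural, one-sided (in general non-invertible) associator dg functor $\alpha:(C\tilde\otimes D)\tilde\otimes E\to C\tilde\otimes(D\tilde\otimes E)$ satisfying the pentagon and unit axioms. It is the identity on objects and on generators it is given by the evident identification on $f\otimes\mathrm{id}\otimes\mathrm{id}$, $\mathrm{id}\otimes g\otimes\mathrm{id}$, $\mathrm{id}\otimes\mathrm{id}\otimes h$; by $\varepsilon(f;g_1,\dots,g_k)\otimes\mathrm{id}\mapsto\varepsilon(f;g_1\otimes\mathrm{id},\dots,g_k\otimes\mathrm{id})$; $\varepsilon(f\otimes\mathrm{id};h_1,\dots,h_n)\mapsto\varepsilon(f;\mathrm{id}\otimes h_1,\dots,\mathrm{id}\otimes h_n)$; $\varepsilon(\mathrm{id}\otimes g;h_1,\dots,h_n)\mapsto\mathrm{id}\otimes\varepsilon(g;h_1,\dots,h_n)$; and $$\varepsilon(\varepsilon(f;g_1,\dots,g_k);h_1,\dots,h_N)\mapsto\sum_{0\le i_1\le j_1\le\dots\le i_k\le j_k\le N}\pm\varepsilon\big(f;h_1,\dots,h_{i_1},\varepsilon(g_1;h_{i_1+1},\dots,h_{j_1}),h_{j_1+1},\dots,h_{i_k},\varepsilon(g_k;h_{i_k+1},\dots,h_{j_k}),\dots,h_N\big)$$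 with Koszul signs, where $\varepsilon(g_\ell;\,)$ means $g_\ell\otimes\mathrm{id}$ and each $h_j$ standing alone means $\mathrm{id}\otimes h_j$. **$\tilde\otimes$-monoid sharing the unit.** A dg algebra $B$ with a dg algebra map $m:B\tilde\otimes B\to B$ such that $m\circ(m\tilde\otimes\mathrm{id})=m\circ(\mathrm{id}\tilde\otimes m)\circ\alpha$ on $(B\tilde\otimes B)\tilde\otimes B$, and $m(1_B\otimes b)=m(b\otimes1_B)=b$ for all $b\in B$, where $1_B$ is the unit of the dg algebra $B$. **Brace operad.** A $B_\infty$-algebra structure on a complex $X$ is a dg bialgebra structure on the cofree tensor coalgebra of $X[1]$ (with positive part $T_+^\vee(X[1])=X[1]\oplus X[1]^{\otimes2}\oplus\cdots$), whose underlying coalgebra is the cofree one; it is given by Taylor components $p_n:X^{\otimes n}\to X[2-n]$, $n\ge1$, of the differential ($p_1$ being the differential of $X$) and $q_{m,n}:X^{\otimes m}\otimes X^{\otimes n}\to X[1-m-n]$ of the product. The operad $\mathbf{Br}$ is the quotient of the operad of $B_\infty$-algebras by the relations $q_{m,n}=0$ for $m\ge2$; thus a $\mathbf{Br}$-algebra is a $B_\infty$-algebra with $q_{m,n}=0$ for all $m\ge2$. One writes $x\cup y=p_2(x\otimes y)$ and $x\{y_1,\dots,y_n\}=\{x;y_1,\dots,y_n\}=q_{1,n}(x\otimes y_1\otimes\dots\otimes y_n)$. The differential on $T_+^\vee(B[1])$ is the bar-differential of the dg algebra $B$ when $p_1$ is the differential of $B$, $p_2$ is its product and $p_n=0$ for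 $n\ge3$.
   Formalization: On the Br side the formal statement also requires the braces to share the unit of B, i.e. x{...,1,...} = 0; without this the ''if'' direction fails, e.g. for B the endomorphism dg algebra of the acyclic complex k → k. *)

(* Defs.v *)
From HB Require Import structures.
From mathcomp Require Import all_boot all_algebra.
From mathcomp Require Import generic_quotient.
From mathcomp Require Import boolp.
Set Implicit Arguments.
Unset Strict Implicit.
Unset Printing Implicit Defensive.
Import GRing.Theory.
Local Open Scope ring_scope.
Local Open Scope quotient_scope.

(** Complexes are cohomologically Z-graded families [X : int -> lmodType k];
    only homogeneous elements occur.  [elt X] is the type of homogeneous
    elements of arbitrary degree.  Two elements of degrees that agree only
    propositionally are compared either as members of [elt X] or after
    [hpart n], which reindexes an element of degree [n] to [X n] (and sends
    elements of other degrees to 0). *)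
Section Graded.
Variables (k : fieldType) (X : int -> lmodType k).

Definition elt : Type := {i : int & X i}.
Definition el (i : int) (x : X i) : elt := existT (fun i => X i : Type) i x.
Definition deg (x : elt) : int := projT1 x.
Definition val_el (x : elt) : X (deg x) := projT2 x.

Definition hpart (n : int) (x : elt) : X n :=
  match deg x =P n with
  | ReflectT e => eq_rect (deg x) (fun m => X m : Type) (val_el x) n e
  | ReflectF _ => 0
  end.

(** A word [:: y1; ...; yn] stands for the tensor s y1 (x) ... (x) s yn of
    X[1] (x) ... (x) X[1], where X[1]^i = X^(i+1); [sdeg] is its degree. *)
Definition word : Type := seq elt.
Definition sdeg (v : word) : int := \sum_(y <- v) (deg y - 1).

Lemma hpart_el i (x : X i) : hpart i (el x) = x.
Proof.
rewrite /hpart /=; case: eqP => [e|/(_ erefl)//].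
by rewrite (eq_axiomK e).
Qed.

Lemma hpart_ne n (x : elt) : deg x <> n -> hpart n x = 0.
Proof. by rewrite /hpart; case: eqP. Qed.

Lemma el_val (x : elt) : el (val_el x) = x.
Proof. by case: x. Qed.

Lemma elt_ext (x y : elt) :
  deg x = deg y -> (forall n, hpart n x = hpart n y) -> x = y.
Proof.
case: x y => [i x] [j y] /= e; case: j / e y => y H.
by have := H i; rewrite (hpart_el x) (hpart_el y) => ->.
Qed.

Lemma hpartD (n i : int) (a : k) (x y : X i) :
  hpart n (el (a *: x + y)) = a *: hpart n (el x) + hpart n (el y).
Proof.
case: (eqVneq i n) => [e|ne]; first by case: n / e; rewrite !hpart_el.
by rewrite !hpart_ne ?scaler0 ?addr0 //; apply/eqP.
Qed.

End Graded.
Arguments el {k X i} x.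
Arguments deg {k X} x.
Arguments sdeg {k X} v.

Record dgAlg (k : fieldType) := DgAlg {
  dg_car :> int -> lmodType k;
  dg1 : dg_car 0;
  dgM : forall i j, dg_car i -> dg_car j -> dg_car (i + j);
  dgD : forall i, dg_car i -> dg_car (i + 1);
  dgM_linl : forall i j a (x x' : dg_car i) (y : dg_car j),
    dgM (a *: x + x') y = a *: dgM x y + dgM x' y;
  dgM_linr : forall i j a (x : dg_car i) (y y' : dg_car j),
    dgM x (a *: y + y') = a *: dgM x y + dgM x y';
  dgM_assoc : forall i j l (x : dg_car i) (y : dg_car j) (z : dg_car l),
    el (dgM x (dgM y z)) = el (dgM (dgM x y) z);
  dgM_1l : forall i (x : dg_car i), el (dgM dg1 x) = el x;
  dgM_1r : forall i (x : dg_car i), el (dgM x dg1) = el x;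
  dgD_lin : forall i a (x y : dg_car i), dgD (a *: x + y) = a *: dgD x + dgD y;
  dgD_sq : forall i (x : dg_car i), dgD (dgD x) = 0;
  dgD_leibniz : forall i j (x : dg_car i) (y : dg_car j),
    dgD (dgM x y) = hpart (i + j + 1) (el (dgM (dgD x) y))
                    + (-1) ^ i *: hpart (i + j + 1) (el (dgM x (dgD y)))
}.
Arguments dg1 {k d}.
Arguments dgM {k d i j} x y.
Arguments dgD {k d i} x.

Section Ops.
Variables (k : fieldType) (A : dgAlg k).
Definition e1 : elt A := el dg1.
Definition emul (x y : elt A) : elt A := el (dgM (val_el x) (val_el y)).
Definition ed (x : elt A) : elt A := el (dgD (val_el x)).
End Ops.
Arguments e1 {k A}.

Record dgHom (k : fieldType) (A B : dgAlg k) := DgHom {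
  hom_fun :> forall i, A i -> B i;
  hom_lin : forall i a (x y : A i),
    hom_fun (a *: x + y) = a *: hom_fun x + hom_fun y;
  hom_1 : hom_fun dg1 = dg1;
  hom_M : forall i j (x : A i) (y : A j),
    hom_fun (dgM x y) = dgM (hom_fun x) (hom_fun y);
  hom_D : forall i (x : A i), hom_fun (dgD x) = dgD (hom_fun x)
}.

Definition emap (k : fieldType) (A B : dgAlg k) (f : dgHom A B) (x : elt A) :
  elt B := el (f _ (val_el x)).

(** Coderivations and coalgebra maps of the tensor coalgebra of X[1], computed
    on words as formal linear combinations of words. *)
Section Coalgebra.
Variables (k : fieldType) (X : int -> lmodType k).

(** The coderivation of degree 1 with components [b] (no component in
    arity 0): sum over v = u w z, w nonempty, of (-1)^|u| u b(w) z. *)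
Definition coder (b : word X -> elt X) (v : word X) : seq (k * word X) :=
  [seq ((-1) ^ sdeg (take i v),
        take i v ++ b (take j.+1 (drop i v)) :: drop (i + j.+1) v)
  | i <- iota 0 (size v), j <- iota 0 (size v - i)].

(** The coalgebra map T(X[1]) (x) T(X[1]) -> T(X[1]) with components [q]:
    sum over u = u1 ... ur, v = v1 ... vr with no pair (ui, vi) empty of
    +- q(u1, v1) ... q(ur, vr), with Koszul sign.  The fuel [N] bounds r. *)
Fixpoint cofree_mul_rec (q : word X -> word X -> elt X) (N : nat) (u v : word X) :
    seq (k * word X) :=
  match N with
  | N'.+1 => if (size u + size v == 0)%N then [:: (1, [::])] else
      flatten [seq
        [seq ((-1) ^ (sdeg (drop i u) * sdeg (take j v)) * t.1,
              q (take i u) (take j v) :: t.2)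
        | t <- cofree_mul_rec q N' (drop i u) (drop j v)]
      | i <- iota 0 (size u).+1,
        j <- [seq j <- iota 0 (size v).+1 | 0 < i + j]%N]
  | 0 => [:: (1, [::])]
  end.
Definition cofree_mul (q : word X -> word X -> elt X) (u v : word X) :=
  cofree_mul_rec q (size u + size v) u v.

(** The component in degree [n] of the value on a formal combination of
    words of the multilinear map [F]. *)
Definition lsum (Y : int -> lmodType k) (n : int) (F : word X -> elt Y)
    (s : seq (k * word X)) : Y n := \sum_(t <- s) t.1 *: hpart n (F t.2).

End Coalgebra.

(** Components of the bar differential of T(A[1]):
    s x |-> s dx,  s x (x) s y |-> (-1)^|x| s(xy). *)
Definition bar (k : fieldType) (A : dgAlg k) (v : word A) : elt A :=
  match v with
  | [:: x] => ed x
  | [:: x; y] => el ((-1) ^ deg x *: val_el (emul x y))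
  | _ => el (0 : A (sdeg v + 2))
  end.

(** A dg algebra map out of the twisted tensor product of C and D, in terms of
    the generators: [pL f] is the image of f (x) id, [pR g] that of
    id (x) g, and [pE f [:: g_n; ...; g_1]] that of eps(f; g_1, ..., g_n)
    (arguments are listed in the order in which they are composed).
    Equivalently: the dg algebra map f |-> [pE f] from C to the reduced
    Hochschild complex of D with values in E, a D-bimodule along [pR]. *)
Record pairing (k : fieldType) (C D E : dgAlg k) := Pairing {
  pL : dgHom C E;
  pR : dgHom D E;
  pE : elt C -> word D -> elt E;
  pE_deg : forall f v, deg (pE f v) = deg f + sdeg v;
  pE_linl : forall n i a (f f' : C i) v,
    hpart n (pE (el (a *: f + f')) v)
    = a *: hpart n (pE (el f) v) + hpart n (pE (el f') v);
  pE_linr : forall n f u j a (g g' : D j) v,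
    hpart n (pE f (u ++ el (a *: g + g') :: v))
    = a *: hpart n (pE f (u ++ el g :: v)) + hpart n (pE f (u ++ el g' :: v));
  pE_nil : forall f, pE f [::] = emap pL f;
  pE_1l : forall n v, (0 < size v)%N -> hpart n (pE e1 v) = 0;
  pE_1r : forall n f u v, hpart n (pE f (u ++ e1 :: v)) = 0;
  pE_mul : forall n f2 f1 v,
    hpart n (pE (emul f2 f1) v)
    = \sum_(0 <= m < (size v).+1) (-1) ^ (deg f1 * sdeg (take m v)) *:
        hpart n (emul (pE f2 (take m v)) (pE f1 (drop m v)));
  pE_d : forall n f y v,
    hpart n (ed (pE f (y :: v)))
    = hpart n (pE (ed f) (y :: v))
      - (-1) ^ deg f *: lsum n (pE f) (coder (@bar k D) (y :: v))
      + (-1) ^ (deg f * (deg y - 1)) *: hpart n (emul (emap pR y) (pE f v))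
      - (-1) ^ (deg f + sdeg (belast y v)) *:
          hpart n (emul (pE f (belast y v)) (emap pR (last y v)))
}.

(** The twisted tensor product: formal expressions in the generators, modulo
    the identities that hold under every pairing.  (Since quotients by the
    defining relations are themselves targets of a pairing, these are exactly
    the consequences of the relations listed in [pairing].) *)
Section TwistedTensor.
Variables (k : fieldType) (C D : dgAlg k).

Inductive term : int -> Type :=
| T0 i : term i
| TAdd i of term i & term i : term i
| TScale i of k & term i : term i
| T1 : term 0
| TMul i j of term i & term j : term (i + j)
| TDiff i of term i : term (i + 1)
| TInl i of C i : term i
| TInr i of D i : term i
| TEps (f : elt C) (v : word D) : term (deg f + sdeg v).

Fixpoint eval (E : dgAlg k) (P : pairing C D E) (i : int) (t : term i) : E i :=
  match t in term i return E i with
  | T0 _ => 0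
  | TAdd _ s t => eval P s + eval P t
  | TScale _ a t => a *: eval P t
  | T1 => dg1
  | TMul _ _ s t => dgM (eval P s) (eval P t)
  | TDiff _ t => dgD (eval P t)
  | TInl _ f => pL P _ f
  | TInr _ g => pR P _ g
  | TEps f v => hpart (deg f + sdeg v) (pE P f v)
  end.

HB.instance Definition _ i := gen_eqMixin (term i).
HB.instance Definition _ i := gen_choiceMixin (term i).

Definition term_eq (i : int) (s t : term i) : bool :=
  `[< forall (E : dgAlg k) (P : pairing C D E), eval P s = eval P t >].

Lemma term_eq_refl i : reflexive (@term_eq i).
Proof. by move=> t; apply/asboolP. Qed.
Lemma term_eq_sym i : symmetric (@term_eq i).
Proof. by move=> s t; apply/asboolP/asboolP => H E P; rewrite H. Qed.
Lemma term_eq_trans i : transitive (@term_eq i).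
Proof.
by move=> t s r /asboolP H /asboolP K; apply/asboolP => E P; rewrite H.
Qed.
Canonical term_eqv i : equiv_rel (term i) :=
  EquivRel (@term_eq i) (@term_eq_refl i) (@term_eq_sym i) (@term_eq_trans i).

Definition tw (i : int) : Type := {eq_quot (term_eqv i)}.
HB.instance Definition _ i := Choice.on (tw i).

Definition cls (i : int) (t : term i) : tw i := (\pi_({eq_quot (term_eqv i)}) t)%qT.
Definition rep (i : int) (x : tw i) : term i := repr (x : {eq_quot (term_eqv i)}).
Definition evq (E : dgAlg k) (P : pairing C D E) (i : int) (x : tw i) : E i :=
  eval P (rep x).

Lemma evq_cls E (P : pairing C D E) i (t : term i) : evq P (cls t) = eval P t.
Proof.
have /eqmodP /asboolP H : (repr (\pi_({eq_quot (term_eqv i)}) t) = t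
   %[mod {eq_quot (term_eqv i)}])%qT by rewrite reprK.
exact: H.
Qed.

Lemma tw_ext i (x y : tw i) :
  (forall E (P : pairing C D E), evq P x = evq P y) -> x = y.
Proof.
move=> H; rewrite -[x](reprK (x : {eq_quot (term_eqv i)})).
rewrite -[y](reprK (y : {eq_quot (term_eqv i)})).
by apply/eqmodP/asboolP.
Qed.

Definition tw_add i (x y : tw i) := cls (TAdd (rep x) (rep y)).
Definition tw_scale i a (x : tw i) := cls (TScale a (rep x)).
Definition tw_opp i (x : tw i) := tw_scale (-1) x.
Definition tw_zero i : tw i := cls (T0 i).

Lemma tw_addE E (P : pairing C D E) i (x y : tw i) :
  evq P (tw_add x y) = evq P x + evq P y.
Proof. by rewrite evq_cls. Qed.
Lemma tw_scaleE E (P : pairing C D E) i a (x : tw i) :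
  evq P (tw_scale a x) = a *: evq P x.
Proof. by rewrite evq_cls. Qed.
Lemma tw_zeroE E (P : pairing C D E) i : evq P (tw_zero i) = 0.
Proof. by rewrite evq_cls. Qed.
Let twE := (tw_addE, tw_scaleE, tw_zeroE).

Lemma tw_addA i : associative (@tw_add i).
Proof. by move=> x y z; apply: tw_ext => E P; rewrite !twE addrA. Qed.
Lemma tw_addC i : commutative (@tw_add i).
Proof. by move=> x y; apply: tw_ext => E P; rewrite !twE addrC. Qed.
Lemma tw_add0 i : left_id (tw_zero i) (@tw_add i).
Proof. by move=> x; apply: tw_ext => E P; rewrite !twE add0r. Qed.
Lemma tw_addN i : left_inverse (tw_zero i) (@tw_opp i) (@tw_add i).
Proof. by move=> x; apply: tw_ext => E P; rewrite !twE scaleN1r addNr. Qed.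
HB.instance Definition _ i := GRing.isZmodule.Build (tw i)
  (@tw_addA i) (@tw_addC i) (@tw_add0 i) (@tw_addN i).

Lemma tw_scaleA i a b (x : tw i) :
  tw_scale a (tw_scale b x) = tw_scale (a * b) x.
Proof. by apply: tw_ext => E P; rewrite !twE scalerA. Qed.
Lemma tw_scale1 i : left_id 1 (@tw_scale i).
Proof. by move=> x; apply: tw_ext => E P; rewrite !twE scale1r. Qed.
Lemma tw_scaleDr i : right_distributive (@tw_scale i) +%R.
Proof. by move=> a x y; apply: tw_ext => E P; rewrite !twE scalerDr. Qed.
Lemma tw_scaleDl i (x : tw i) : {morph (@tw_scale i)^~ x : a b / a + b}.
Proof. by move=> a b; apply: tw_ext => E P; rewrite !twE scalerDl. Qed.
HB.instance Definition _ i := GRing.Zmodule_isLmodule.Build k (tw i)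
  (@tw_scaleA i) (@tw_scale1 i) (@tw_scaleDr i) (@tw_scaleDl i).

Definition twl (i : int) : lmodType k := tw i.
Definition tw_one : twl 0 := cls T1.
Definition tw_mul i j (x : twl i) (y : twl j) : twl (i + j) :=
  cls (TMul (rep x) (rep y)).
Definition tw_diff i (x : twl i) : twl (i + 1) := cls (TDiff (rep x)).

Section Eval.
Variables (E : dgAlg k) (P : pairing C D E).
Definition ev i (x : twl i) : E i := evq P x.
Lemma ev_lin i a (x y : twl i) : ev (a *: x + y) = a *: ev x + ev y.
Proof. by rewrite /ev tw_addE tw_scaleE. Qed.
Lemma ev_0 i : ev (0 : twl i) = 0.
Proof. exact: tw_zeroE. Qed.
Lemma ev_1 : ev tw_one = dg1.
Proof. exact: evq_cls. Qed.
Lemma ev_M i j (x : twl i) (y : twl j) : ev (tw_mul x y) = dgM (ev x) (ev y).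
Proof. exact: evq_cls. Qed.
Lemma ev_D i (x : twl i) : ev (tw_diff x) = dgD (ev x).
Proof. exact: evq_cls. Qed.
Lemma ev_hpart n (x : elt twl) :
  ev (hpart n x) = hpart n (el (ev (val_el x))).
Proof.
case: x => i x; case: (eqVneq i n) => [e|/eqP ne].
  by case: n / e; rewrite (hpart_el x) hpart_el.
by rewrite !hpart_ne // ev_0.
Qed.
End Eval.

Lemma tw_elt_ext (x y : elt twl) : deg x = deg y ->
  (forall E (P : pairing C D E), el (ev P (val_el x)) = el (ev P (val_el y))) ->
  x = y.
Proof.
move=> e H; apply: elt_ext e _ => n; apply: tw_ext => E P.
by rewrite -!/(ev P _) !ev_hpart H.
Qed.

Lemma tw_linl i j a (x x' : twl i) (y : twl j) :
  tw_mul (a *: x + x') y = a *: tw_mul x y + tw_mul x' y.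
Proof.
by apply: tw_ext => E P; rewrite -!/(ev P _) !(ev_M, ev_lin) dgM_linl.
Qed.
Lemma tw_linr i j a (x : twl i) (y y' : twl j) :
  tw_mul x (a *: y + y') = a *: tw_mul x y + tw_mul x y'.
Proof.
by apply: tw_ext => E P; rewrite -!/(ev P _) !(ev_M, ev_lin) dgM_linr.
Qed.
Lemma tw_assoc i j l (x : twl i) (y : twl j) (z : twl l) :
  el (tw_mul x (tw_mul y z)) = el (tw_mul (tw_mul x y) z).
Proof.
by apply: tw_elt_ext => [|E P] /=; rewrite ?addrA // !ev_M dgM_assoc.
Qed.
Lemma tw_1l i (x : twl i) : el (tw_mul tw_one x) = el x.
Proof.
by apply: tw_elt_ext => [|E P] /=; rewrite ?add0r // ev_M ev_1 dgM_1l.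
Qed.
Lemma tw_1r i (x : twl i) : el (tw_mul x tw_one) = el x.
Proof.
by apply: tw_elt_ext => [|E P] /=; rewrite ?addr0 // ev_M ev_1 dgM_1r.
Qed.
Lemma tw_dlin i a (x y : twl i) :
  tw_diff (a *: x + y) = a *: tw_diff x + tw_diff y.
Proof.
by apply: tw_ext => E P; rewrite -!/(ev P _) !(ev_D, ev_lin) dgD_lin.
Qed.
Lemma tw_dsq i (x : twl i) : tw_diff (tw_diff x) = 0.
Proof. by apply: tw_ext => E P; rewrite -!/(ev P _) !ev_D dgD_sq ev_0. Qed.
Lemma tw_leibniz i j (x : twl i) (y : twl j) :
  tw_diff (tw_mul x y) = hpart (i + j + 1) (el (tw_mul (tw_diff x) y))
                 + (-1) ^ i *: hpart (i + j + 1) (el (tw_mul x (tw_diff y))).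
Proof.
apply: tw_ext => E P; rewrite -!/(ev P _) [hpart _ _ + _]addrC.
by rewrite ev_lin !ev_hpart /= !(ev_D, ev_M) dgD_leibniz [RHS]addrC.
Qed.

Definition twt : dgAlg k := DgAlg tw_linl tw_linr tw_assoc tw_1l tw_1r
  tw_dlin tw_dsq tw_leibniz.

Definition inl_fun i (f : C i) : twt i := cls (TInl f).
Definition inr_fun i (g : D i) : twt i := cls (TInr g).
Definition eps (f : elt C) (v : word D) : elt twt := el (cls (TEps f v) : twt _).

Definition lift (E : dgAlg k) (P : pairing C D E) : dgHom twt E :=
  @DgHom k twt E (@ev E P) (@ev_lin E P) (@ev_1 E P) (@ev_M E P) (@ev_D E P).

Lemma lift_inl E (P : pairing C D E) i (f : C i) : lift P _ (inl_fun f) = pL P _ f.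
Proof. exact: evq_cls. Qed.
Lemma lift_inr E (P : pairing C D E) i (g : D i) : lift P _ (inr_fun g) = pR P _ g.
Proof. exact: evq_cls. Qed.
Lemma lift_eps E (P : pairing C D E) f v : emap (lift P) (eps f v) = pE P f v.
Proof.
rewrite /emap /= /ev evq_cls /=; case: (pE P f v) (pE_deg P f v) => i x /= e.
by case: _ / e; rewrite (hpart_el x).
Qed.

Lemma twt_ext i (x y : twt i) :
  (forall E (P : pairing C D E), lift P _ x = lift P _ y) -> x = y.
Proof. exact: tw_ext. Qed.

End TwistedTensor.

Section Homs.
Variables (k : fieldType) (A B : dgAlg k) (f : dgHom A B).

Lemma hom_0 i : f i 0 = 0.
Proof. by have := hom_lin f (-1) (0 : A i) 0; rewrite scaler0 addr0 scaleN1r addNr. Qed.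
Lemma hom_add i (x y : A i) : f i (x + y) = f i x + f i y.
Proof. by have := hom_lin f 1 x y; rewrite !scale1r. Qed.
Lemma hom_scale i a (x : A i) : f i (a *: x) = a *: f i x.
Proof. by have := hom_lin f a x 0; rewrite !addr0 hom_0 addr0. Qed.
Lemma hom_opp i (x : A i) : f i (- x) = - f i x.
Proof. by rewrite -scaleN1r hom_scale scaleN1r. Qed.
Lemma hom_sum i I (r : seq I) (F : I -> A i) :
  f i (\sum_(t <- r) F t) = \sum_(t <- r) f i (F t).
Proof. exact: (big_morph (f i) (@hom_add i) (hom_0 i)). Qed.
Lemma hom_hpart n (x : elt A) : f n (hpart n x) = hpart n (emap f x).
Proof.
case: x => i x; case: (eqVneq i n) => [e|/eqP ne].
  by case: n / e; rewrite (hpart_el x) (hpart_el (f i x)).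
by rewrite !hpart_ne // hom_0.
Qed.
Lemma emap_el i (x : A i) : emap f (el x) = el (f i x).
Proof. by []. Qed.
Lemma emap_e1 : emap f e1 = e1.
Proof. by rewrite /emap /= hom_1. Qed.
Lemma emap_mul x y : emap f (emul x y) = emul (emap f x) (emap f y).
Proof. by rewrite /emap /= hom_M. Qed.
Lemma emap_d x : emap f (ed x) = ed (emap f x).
Proof. by rewrite /emap /= hom_D. Qed.
Lemma sdeg_map (v : word A) : sdeg (map (emap f) v) = sdeg v.
Proof. by rewrite /sdeg big_map. Qed.
Lemma emap_bar v : emap f (bar v) = bar (map (emap f) v).
Proof.
case: v => [|x [|y [|z v]]].
- by rewrite emap_el hom_0 -(sdeg_map [::]).
- exact: emap_d.
- by rewrite emap_el hom_scale /= hom_M.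
by rewrite emap_el hom_0 -(sdeg_map [:: x, y, z & v]).
Qed.
Lemma coder_map v : coder (@bar k B) (map (emap f) v)
  = [seq (t.1, map (emap f) t.2) | t <- coder (@bar k A) v].
Proof.
rewrite /coder map_allpairs size_map; congr flatten; apply: eq_map => i.
apply: eq_map => j /=; rewrite -map_take sdeg_map map_cat /= emap_bar.
by rewrite -map_drop -map_take -map_drop.
Qed.
End Homs.

Section Universal.
Variables (k : fieldType) (C D : dgAlg k).
Let T := twt C D.

Let inl_lin i a (x y : C i) :
  inl_fun D (a *: x + y) = a *: inl_fun D x + inl_fun D y.
Proof.
by apply: twt_ext => E P; rewrite !(hom_lin, lift_inl).
Qed.
Let inl_1 : inl_fun D dg1 = dg1 :> T 0.
Proof. by apply: twt_ext => E P; rewrite lift_inl !hom_1. Qed.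
Let inl_M i j (x : C i) (y : C j) :
  inl_fun D (dgM x y) = dgM (inl_fun D x) (inl_fun D y) :> T _.
Proof. by apply: twt_ext => E P; rewrite hom_M !lift_inl hom_M. Qed.
Let inl_D i (x : C i) : inl_fun D (dgD x) = dgD (inl_fun D x) :> T _.
Proof. by apply: twt_ext => E P; rewrite hom_D !lift_inl hom_D. Qed.
Definition inl : dgHom C T := DgHom inl_lin inl_1 inl_M inl_D.

Let inr_lin i a (x y : D i) :
  inr_fun C (a *: x + y) = a *: inr_fun C x + inr_fun C y.
Proof.
by apply: twt_ext => E P; rewrite !(hom_lin, lift_inr).
Qed.
Let inr_1 : inr_fun C dg1 = dg1 :> T 0.
Proof. by apply: twt_ext => E P; rewrite lift_inr !hom_1. Qed.
Let inr_M i j (x : D i) (y : D j) :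
  inr_fun C (dgM x y) = dgM (inr_fun C x) (inr_fun C y) :> T _.
Proof. by apply: twt_ext => E P; rewrite hom_M !lift_inr hom_M. Qed.
Let inr_D i (x : D i) : inr_fun C (dgD x) = dgD (inr_fun C x) :> T _.
Proof. by apply: twt_ext => E P; rewrite hom_D !lift_inr hom_D. Qed.
Definition inr : dgHom D T := DgHom inr_lin inr_1 inr_M inr_D.

Let emap_inl E (P : pairing C D E) f : emap (lift P) (emap inl f) = emap (pL P) f.
Proof. exact: (congr1 el (lift_inl P _)). Qed.
Let emap_inr E (P : pairing C D E) f : emap (lift P) (emap inr f) = emap (pR P) f.
Proof. exact: (congr1 el (lift_inr P _)). Qed.

Let elt_ext_lift (x y : elt T) : deg x = deg y ->
  (forall E (P : pairing C D E), emap (lift P) x = emap (lift P) y) -> x = y.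
Proof. exact: tw_elt_ext. Qed.

Definition univ : pairing C D T.
Proof.
apply: (@Pairing k C D T inl inr (@eps k C D)).
- by [].
- move=> n i a f f' v; apply: twt_ext => E P.
  by rewrite hom_lin !hom_hpart !lift_eps pE_linl.
- move=> n f u j a g g' v; apply: twt_ext => E P.
  by rewrite hom_lin !hom_hpart !lift_eps pE_linr.
- move=> f; apply: elt_ext_lift => [|E P].
    by rewrite /= /sdeg big_nil addr0.
  by rewrite lift_eps pE_nil emap_inl.
- move=> n v v0; apply: twt_ext => E P.
  by rewrite hom_hpart lift_eps hom_0 pE_1l.
- move=> n f u v; apply: twt_ext => E P.
  by rewrite hom_hpart lift_eps hom_0 pE_1r.
- move=> n f2 f1 v; apply: twt_ext => E P.
  rewrite hom_hpart lift_eps pE_mul hom_sum; apply: eq_bigr => m _.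
  by rewrite hom_scale hom_hpart emap_mul !lift_eps.
- move=> n f y v; apply: twt_ext => E P.
  rewrite !(hom_add, hom_opp, hom_scale, hom_hpart, hom_sum).
  rewrite emap_d !emap_mul !emap_inr !lift_eps pE_d; congr (_ - _ *: _ + _ - _).
  by apply: eq_bigr => t _; rewrite hom_scale hom_hpart lift_eps.
Defined.
End Universal.
Arguments inl {k} C D.
Arguments inr {k} C D.

Section Functoriality.
Variables (k : fieldType) (C C' D D' : dgAlg k).
Variables (phi : dgHom C C') (psi : dgHom D D').

Definition comp_hom (A B E : dgAlg k) (g : dgHom B E) (f : dgHom A B) :
  dgHom A E.
Proof.
by exists (fun i x => g i (f i x)) => *; rewrite !(hom_lin, hom_1, hom_M, hom_D).
Defined.

Definition pullback E (P : pairing C' D' E) : pairing C D E.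
Proof.
apply: (@Pairing k C D E (comp_hom (pL P) phi) (comp_hom (pR P) psi)
  (fun f v => pE P (emap phi f) (map (emap psi) v))).
- by move=> f v; rewrite pE_deg sdeg_map.
- by move=> n i a f f' v; rewrite emap_el hom_lin pE_linl.
- by move=> n f u j a g g' v; rewrite !map_cat /= emap_el hom_lin pE_linr.
- by move=> f; rewrite pE_nil.
- by move=> n v v0; rewrite emap_e1 pE_1l ?size_map.
- by move=> n f u v; rewrite map_cat /= emap_e1 pE_1r.
- move=> n f2 f1 v; rewrite emap_mul pE_mul size_map; apply: eq_bigr => m _.
  by rewrite -map_take sdeg_map -map_drop.
- move=> n f y v; rewrite pE_d -emap_d -(map_cons (emap psi)) coder_map.
  rewrite /lsum big_map last_map.
  have -> : belast (emap psi y) (map (emap psi) v) = map (emap psi) (belast y v).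
    by elim: v y => //= z v IH y; rewrite IH.
  by rewrite sdeg_map.
Defined.

Definition tw_map : dgHom (twt C D) (twt C' D') := lift (pullback (univ C' D')).

Lemma tw_map_inl i (f : C i) : tw_map _ (inl C D _ f) = inl C' D' _ (phi _ f).
Proof. exact: lift_inl. Qed.
Lemma tw_map_inr i (g : D i) : tw_map _ (inr C D _ g) = inr C' D' _ (psi _ g).
Proof. exact: lift_inr. Qed.
Lemma tw_map_eps f v :
  emap tw_map (eps f v) = eps (emap phi f) (map (emap psi) v).
Proof. exact: lift_eps. Qed.
End Functoriality.

Definition id_hom (k : fieldType) (A : dgAlg k) : dgHom A A :=
  @DgHom k A A (fun i x => x) (fun _ _ _ _ => erefl) erefl
    (fun _ _ _ _ => erefl) (fun _ _ => erefl).

Section Associator.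
Variables (k : fieldType) (C D E : dgAlg k).

(** The sum over all ways of inserting the letters of [gs], in order, into
    [hs], each letter g absorbing a (possibly empty) block h' of consecutive
    letters of [hs] into eps(g; h'); the other letters h of [hs] become
    id (x) h.  Koszul signs for the degrees in D[1] and E[1]. *)
Fixpoint insert (gs : word D) (hs : word E) : seq (k * word (twt D E)) :=
  match gs with
  | [::] => [:: (1, map (emap (inr D E)) hs)]
  | g :: gs' => flatten [seq
      [seq ((-1) ^ (sdeg (take i hs) * sdeg gs
                    + sdeg (take j (drop i hs)) * sdeg gs') * t.1,
            map (emap (inr D E)) (take i hs)
              ++ eps g (take j (drop i hs)) :: t.2)
      | t <- insert gs' (drop (i + j) hs)]
    | i <- iota 0 (size hs).+1, j <- iota 0 (size hs - i).+1]
  end.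

(** The values of the associator on generators; they determine it. *)
Record is_associator (alpha : dgHom (twt (twt C D) E) (twt C (twt D E))) : Prop :=
  IsAssociator {
  assoc_inll : forall i (f : C i),
    alpha _ (inl (twt C D) E _ (inl C D _ f)) = inl C (twt D E) _ f;
  assoc_inlr : forall i (g : D i),
    alpha _ (inl (twt C D) E _ (inr C D _ g)) = inr C (twt D E) _ (inl D E _ g);
  assoc_inr : forall i (h : E i),
    alpha _ (inr (twt C D) E _ h) = inr C (twt D E) _ (inr D E _ h);
  assoc_eps : forall f (gs : word D),
    emap alpha (emap (inl (twt C D) E) (eps f gs))
    = eps f (map (emap (inl D E)) gs);
  assoc_epsl : forall f (hs : word E),
    emap alpha (eps (emap (inl C D) f) hs) = eps f (map (emap (inr D E)) hs);
  assoc_epsr : forall g (hs : word E),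
    emap alpha (eps (emap (inr C D) g) hs)
    = emap (inr C (twt D E)) (eps g hs);
  assoc_epseps : forall n f (gs : word D) (hs : word E),
    hpart n (emap alpha (eps (eps f gs) hs))
    = lsum n (@eps k C (twt D E) f) (insert gs hs)
}.
End Associator.

Record is_tw_monoid (k : fieldType) (B : dgAlg k)
    (alpha : dgHom (twt (twt B B) B) (twt B (twt B B)))
    (m : dgHom (twt B B) B) : Prop := IsTwMonoid {
  twm_assoc : forall i (x : twt (twt B B) B i),
    m _ (tw_map m (id_hom B) _ x) = m _ (tw_map (id_hom B) m _ (alpha _ x));
  twm_1l : forall i (b : B i), m _ (inr B B _ b) = b;
  twm_1r : forall i (b : B i), m _ (inl B B _ b) = b
}.

(** A B_infinity structure: a dg bialgebra structure on the tensor coalgebra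
    T(X[1]) with unit the empty word.  [b] and [q] are the components of the
    differential and of the product, as multilinear maps on X[1]: they have
    degrees 1 and 0 there, and p_n corresponds to [b] by
    b(s x1, ..., s xn) = (-1)^(sum_i (n-i)|xi|) s p_n(x1, ..., xn).
    A coderivation, or a difference of two coalgebra maps, vanishes as soon as
    its component in X[1] does, so only those components of the bialgebra
    identities are required. *)
Record is_Binf (k : fieldType) (X : int -> lmodType k)
    (b : word X -> elt X) (q : word X -> word X -> elt X) : Prop := IsBinf {
  Binf_b_deg : forall v, deg (b v) = sdeg v + 2;
  Binf_b_lin : forall n u j a (x x' : X j) v,
    hpart n (b (u ++ el (a *: x + x') :: v))
    = a *: hpart n (b (u ++ el x :: v)) + hpart n (b (u ++ el x' :: v));
  Binf_b_nil : forall n, hpart n (b [::]) = 0;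
  Binf_q_deg : forall u v, deg (q u v) = sdeg u + sdeg v + 1;
  Binf_q_linl : forall n u j a (x x' : X j) v w,
    hpart n (q (u ++ el (a *: x + x') :: v) w)
    = a *: hpart n (q (u ++ el x :: v) w) + hpart n (q (u ++ el x' :: v) w);
  Binf_q_linr : forall n w u j a (x x' : X j) v,
    hpart n (q w (u ++ el (a *: x + x') :: v))
    = a *: hpart n (q w (u ++ el x :: v)) + hpart n (q w (u ++ el x' :: v));
  Binf_q01 : forall x, q [::] [:: x] = x;
  Binf_q10 : forall x, q [:: x] [::] = x;
  Binf_q0n : forall n v, size v != 1%N -> hpart n (q [::] v) = 0;
  Binf_qn0 : forall n u, size u != 1%N -> hpart n (q u [::]) = 0;
  Binf_diff : forall n v, lsum n b (coder b v) = 0;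
  Binf_leibniz : forall n u v,
    lsum n b (cofree_mul q u v)
    = lsum n (q^~ v) (coder b u) + (-1) ^ sdeg u *: lsum n (q u) (coder b v);
  Binf_assoc : forall n u v w,
    lsum n (q^~ w) (cofree_mul q u v) = lsum n (q u) (cofree_mul q v w)
}.

Definition is_Br (k : fieldType) (X : int -> lmodType k)
    (b : word X -> elt X) (q : word X -> word X -> elt X) : Prop :=
  is_Binf b q /\ forall n u v, (1 < size u)%N -> hpart n (q u v) = 0.

(** Compatibility of the braces x{y1, ..., yn} = q [:: x] [:: y1; ...; yn]
    with the unit of B: they vanish when some y_i is the unit.  (Vanishing for
    x the unit and n > 0 is automatic.)  This does not follow from [is_Br]:
    for B = End(V), V the complex k -> k with zero cohomology, h in B of degree
    -1 with dh = 1 and hh = 0, conjugation by 1 + hy gives a Br structure with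
    x{1} = xh - (-1)^|x| hx up to sign, while B has no monoid structure. *)
Definition braces_share_unit (k : fieldType) (B : dgAlg k)
    (q : word B -> word B -> elt B) : Prop :=
  forall n x u v, hpart n (q [:: x] (u ++ e1 :: v)) = 0.

(* Main.v *)
(** A dg algebra map m : B (x)~ B -> B restricting to the identity on both
    factors is determined by the operations x{v} = m(eps(x; v)).  In terms of
    these, the formula for eps(xy; v) is the bialgebra Leibniz identity at
    ([x y], v), and the formula for d eps(x; v) is the one at ([x], v).  Since
    the product components with at least two letters on the left vanish, the
    other Leibniz identities reduce to the axioms of a dg algebra.
    Associativity of m equates two dg algebra maps out of (B (x)~ B) (x)~ B, so
    it can be tested on generators; the only nontrivial case,
    eps(eps(f; g); h), is the brace relation, i.e. associativity of the product
    on the tensor coalgebra at ([f], g, h). *)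
Require Import Defs.
From mathcomp Require Import all_boot all_algebra.
From mathcomp Require Import zify.
From mathcomp Require Import boolp.
Set Implicit Arguments.
Unset Strict Implicit.
Unset Printing Implicit Defensive.
Import GRing.Theory.
Local Open Scope ring_scope.

#[local] Arguments bar : simpl never.

(** * Formal combinations of words *)

Section Signs.
Variable k : fieldType.

Lemma signD (m n : int) : (-1) ^ (m + n) = (-1) ^ m * (-1) ^ n :> k.
Proof. by rewrite expfzDr // oppr_eq0 oner_eq0. Qed.

Lemma sign_double (m : int) : (-1) ^ (m * 2) = 1 :> k.
Proof. by rewrite mulrC -exprz_exp -exprnP sqrrN expr1n exp1rz. Qed.

(** Parity is witnessed by an explicit half-difference [p], so that comparing two signs becomes an
    integer identity within reach of [lia]. *)
Lemma sign_eq (p m n : int) : m = n + p * 2 -> (-1) ^ m = (-1) ^ n :> k.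
Proof. by move=> ->; rewrite signD sign_double mulr1. Qed.

Lemma sign_eqN (p m n : int) : m = n + 1 + p * 2 -> (-1) ^ m = - (-1) ^ n :> k.
Proof. by move=> /sign_eq ->; rewrite signD expr1z mulrN1. Qed.

End Signs.

(** * Null elements and multilinear maps on words *)

Section Null.
Variables (k : fieldType) (X : int -> lmodType k).

(** Zero in whatever degree [x] happens to have: [elt X] has no single zero. *)
Definition null (x : elt X) : Prop := forall n, hpart n x = 0.

Lemma null0 i : null (el (0 : X i)).
Proof.
move=> n; case: (eqVneq i n) => [e|/eqP ne]; last exact: hpart_ne.
by case: n / e; rewrite hpart_el.
Qed.

Lemma null_el0 x : null x -> x = el (0 : X (deg x)).
Proof. by move=> nx; apply: elt_ext => // n; rewrite nx null0. Qed.

Lemma el_inj i (x y : X i) : el x = el y -> x = y.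
Proof. by move/(congr1 (hpart i)); rewrite !hpart_el. Qed.

Lemma hpart_scale n i a (x : X i) : hpart n (el (a *: x)) = a *: hpart n (el x).
Proof. by have := hpartD n a x 0; rewrite addr0 null0 addr0. Qed.

Lemma sdeg_nil : sdeg ([::] : word X) = 0.
Proof. by rewrite /sdeg big_nil. Qed.

Lemma sdeg_cons x (v : word X) : sdeg (x :: v) = deg x - 1 + sdeg v.
Proof. by rewrite /sdeg big_cons. Qed.

End Null.

Section Multilinear.
Variables (k : fieldType) (X Y : int -> lmodType k).

Definition multilinear (F : word X -> elt Y) : Prop :=
  forall n u j a (x x' : X j) v,
    hpart n (F (u ++ el (a *: x + x') :: v))
    = a *: hpart n (F (u ++ el x :: v)) + hpart n (F (u ++ el x' :: v)).

(** The one consequence of multilinearity needed to expand products of braces. It persists when a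
    first letter is fixed, which the inductions below exploit. *)
Definition kills_null (F : word X -> elt Y) : Prop :=
  forall u x v, null x -> null (F (u ++ x :: v)).

Definition kills_longer (p : nat) (F : word X -> elt Y) : Prop :=
  forall v, (p < size v)%N -> null (F v).

(** Linearity at [-1 *: 0 + 0] gives F(0) = -F(0) + F(0) = 0. *)
Lemma multilinear_kills_null F : multilinear F -> kills_null F.
Proof.
move=> linF u x v nx n; rewrite (null_el0 nx).
have := linF n u _ (-1) (0 : X (deg x)) 0 v.
by rewrite scaler0 addr0 scaleN1r addNr.
Qed.

Lemma multilinear_scale n F : multilinear F -> forall u v j a (x : X j),
  hpart n (F (u ++ el (a *: x) :: v)) = a *: hpart n (F (u ++ el x :: v)).
Proof.
move=> linF u v j a x; have := linF n u j a x 0 v; rewrite addr0 => ->.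
by rewrite [X in _ + X]multilinear_kills_null ?addr0 //; apply: null0.
Qed.

Lemma kills_null_cons F x :
  kills_null F -> kills_null (fun w => F (x :: w)).
Proof. by move=> kF u y v; apply: (kF (x :: u)). Qed.

Lemma kills_longer_cons p F x :
  kills_longer p.+1 F -> kills_longer p (fun w => F (x :: w)).
Proof. by move=> kF v pv; apply: kF. Qed.

Lemma eq_lsum n (F G : word X -> elt Y) s :
  (forall w, hpart n (F w) = hpart n (G w)) -> lsum n F s = lsum n G s.
Proof. by move=> FG; apply: eq_bigr => t _; rewrite FG. Qed.

Lemma lsum_nil n (F : word X -> elt Y) : lsum n F [::] = 0.
Proof. exact: big_nil. Qed.

Lemma lsum_cons n (F : word X -> elt Y) a w s :
  lsum n F ((a, w) :: s) = a *: hpart n (F w) + lsum n F s.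
Proof. exact: big_cons. Qed.

Lemma lsum0 n (F : word X -> elt Y) s : (forall w, null (F w)) -> lsum n F s = 0.
Proof. by move=> F0; apply: big1 => t _; rewrite F0 scaler0. Qed.

End Multilinear.

(** * The product on the tensor coalgebra, expanded by number of factors *)

Section CofreeMul.
Variables (k : fieldType) (X Y : int -> lmodType k).
Variable q : word X -> word X -> elt X.
Implicit Types (F : word X -> elt Y) (u v w : word X).

Lemma cofree_mul_recS N u v :
  cofree_mul_rec q N.+1 u v
  = if (size u + size v == 0)%N then [:: (1, [::])] else
    flatten [seq
      [seq ((-1) ^ (sdeg (drop i u) * sdeg (take j v)) * t.1,
            q (take i u) (take j v) :: t.2)
      | t <- cofree_mul_rec q N (drop i u) (drop j v)]
    | i <- iota 0 (size u).+1,
      j <- [seq j <- iota 0 (size v).+1 | 0 < i + j]%N].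
Proof. by []. Qed.

(** Each split removes at least one letter, since [0 < i + j], so the recursion ends within the
    total length and any larger fuel is idle. *)
Lemma cofree_mul_fuel N M u v :
  (size u + size v <= N)%N -> (size u + size v <= M)%N ->
  cofree_mul_rec q N u v = cofree_mul_rec q M u v.
Proof.
elim: N M u v => [|N IH] [|M] u v; rewrite ?cofree_mul_recS.
- by [].
- by rewrite leqn0 => ->.
- by rewrite leqn0 => _ ->.
move=> leN leM; case: ifP => // _.
apply: (congr1 flatten); apply: (congr1 flatten); apply/eq_in_map => i.
rewrite mem_iota => /andP[_ iu]; apply/eq_in_map => j.
rewrite mem_filter => /andP[ij]; rewrite mem_iota => /andP[_ jv].
apply: (congr1 (map _)); apply: IH; rewrite !size_drop; lia.
Qed.

(** Peels off the first factor. The tail is again a [cofree_mul] with its own fuel, so later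
    arguments never mention fuel. *)
Lemma lsum_cofree n F u v : (0 < size u + size v)%N ->
  lsum n F (cofree_mul q u v)
  = \sum_(0 <= i < (size u).+1) \sum_(0 <= j < (size v).+1 | (0 < i + j)%N)
      (-1) ^ (sdeg (drop i u) * sdeg (take j v)) *:
      lsum n (fun w => F (q (take i u) (take j v) :: w))
        (cofree_mul q (drop i u) (drop j v)).
Proof.
move=> uv0; rewrite /lsum /cofree_mul.
case E: (size u + size v)%N uv0 => [|N] // _; rewrite cofree_mul_recS E.
rewrite [(_ == 0)%N]/= big_flatten big_allpairs_dep /index_iota !subn0.
apply: eq_big_seq => i; rewrite mem_iota => /andP[_ iu].
rewrite -[RHS]big_filter. apply: eq_big_seq => j.
rewrite mem_filter => /andP[ij]; rewrite mem_iota => /andP[_ jv].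
rewrite big_map scaler_sumr (@cofree_mul_fuel _ (size (drop i u) + size (drop j v))) //.
  by apply: eq_bigr => t _; rewrite scalerA.
by rewrite !size_drop; lia.
Qed.

Lemma cofree_nonempty n F u v : kills_longer 0 F -> (0 < size u + size v)%N ->
  lsum n F (cofree_mul q u v) = 0.
Proof.
move=> F0 uv0; rewrite lsum_cofree //; apply: big1 => i _; apply: big1 => j _.
by rewrite lsum0 ?scaler0 // => w; apply: F0.
Qed.

(** Only the full split [i = size u], [j = size v] yields a one-letter word; any other leaves a
    nonempty tail behind the first factor. *)
Lemma cofree_linear_part n F u v :
  kills_longer 1 F -> (0 < size u + size v)%N ->
  lsum n F (cofree_mul q u v) = hpart n (F [:: q u v]).
Proof.
move=> F1 uv0; rewrite lsum_cofree // big_nat_recr //= big_nat big1 ?add0r; last first.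
  move=> i /andP[_ iu]; apply: big1 => j ij; rewrite cofree_nonempty ?scaler0 //.
    exact: kills_longer_cons.
  by rewrite !size_drop; lia.
rewrite big_mkcond big_nat_recr //= uv0 big_nat big1 ?add0r; last first.
  move=> j /andP[_ jv]; case: ifP => // ij; rewrite cofree_nonempty ?scaler0 //.
    exact: kills_longer_cons.
  by rewrite !size_drop; lia.
by rewrite !take_size !drop_size sdeg_nil mul0r expr0z scale1r /lsum big_seq1 scale1r.
Qed.

Lemma cofree_quadratic_part n F u v :
  kills_longer 2 F -> (0 < size u + size v)%N ->
  lsum n F (cofree_mul q u v) = hpart n (F [:: q u v])
   + \sum_(0 <= i < (size u).+1)
       \sum_(0 <= j < (size v).+1 | (0 < i + j < size u + size v)%N)
        (-1) ^ (sdeg (drop i u) * sdeg (take j v)) *: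
        hpart n (F [:: q (take i u) (take j v); q (drop i u) (drop j v)]).
Proof.
move=> F2 uv0.
(* After a proper first split the remainder is nonempty, and only its one-factor part survives. *)
have rest i j : (i + j < size u + size v)%N -> (i <= size u)%N -> (j <= size v)%N ->
    lsum n (fun w => F (q (take i u) (take j v) :: w))
           (cofree_mul q (drop i u) (drop j v))
    = hpart n (F [:: q (take i u) (take j v); q (drop i u) (drop j v)]).
  move=> ij iu jv; rewrite cofree_linear_part //; first exact: kills_longer_cons.
  by rewrite !size_drop; lia.
(* The full split is the last entry of the last row: isolating it gives [q u v], and [rest] covers
   all other entries. *)
rewrite lsum_cofree // big_nat_recr //= [in RHS]big_nat_recr //= addrCA; congr (_ + _).
  rewrite !big_nat; apply: eq_bigr => i /andP[_ iu].
  rewrite !(big_mkcond (fun j => 0 < i + j)%N) /= (big_mkcond (fun j => 0 < i + j < _)%N) /=.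
  rewrite !big_nat; apply: eq_bigr => j /andP[_ jv].
  have ij : (i + j < size u + size v)%N by lia.
  by rewrite ij andbT; case: ifP => // _; rewrite rest //; lia.
rewrite big_mkcond [in RHS]big_mkcond !big_nat_recr //= uv0 ltnn addr0 addrC.
congr (_ + _).
  by rewrite !take_size !drop_size sdeg_nil mul0r expr0z scale1r /lsum big_seq1 scale1r.
rewrite !big_nat; apply: eq_bigr => j /andP[_ jv].
have ij : (size u + j < size u + size v)%N by lia.
by rewrite ij andbT; case: ifP => // _; rewrite rest //; lia.
Qed.

End CofreeMul.

(** * Products whose components are braces *)

Section Brace.
Variables (k : fieldType) (X Y : int -> lmodType k).
Variable q : word X -> word X -> elt X.
Hypothesis q01 : forall x, q [::] [:: x] = x.
Hypothesis q0n : forall v, size v != 1%N -> null (q [::] v).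
Hypothesis q2n : forall u v, (1 < size u)%N -> null (q u v).
Implicit Types (F : word X -> elt Y) (u v w gs hs : word X).

Lemma cofree_brace_nil n F v : kills_null F ->
  lsum n F (cofree_mul q [::] v) = hpart n (F v).
Proof.
elim: v F => [|y v IH] F kF; first by rewrite /lsum big_seq1 scale1r.
rewrite lsum_cofree // big_nat1 big_mkcond big_ltn //= add0r big_ltn //=.
rewrite take0 q01 drop0 sdeg_nil mul0r expr0z scale1r IH; last exact: kills_null_cons.
rewrite big_nat big1 ?addr0 // => j /andP[j1 jv]; rewrite add0n; case: ifP => // _.
rewrite lsum0 ?scaler0 // => w; apply: (kF [::]); apply: q0n.
by rewrite size_take; case: ifP => /=; lia.
Qed.

(** The first factor is either a free letter [y] of [v] ([i = 0], where [q [::]] accepts one letter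
    only) or [x] with the block it absorbs ([i = 1]); for [i > 1] it is null. *)
Lemma cofree_brace_cons n F x u v : kills_null F ->
  lsum n F (cofree_mul q (x :: u) v)
  = (if v is y :: v' then
       (-1) ^ (sdeg (x :: u) * (deg y - 1)) *:
         lsum n (fun w => F (y :: w)) (cofree_mul q (x :: u) v')
     else 0)
  + \sum_(0 <= j < (size v).+1) (-1) ^ (sdeg u * sdeg (take j v)) *:
      lsum n (fun w => F (q [:: x] (take j v) :: w)) (cofree_mul q u (drop j v)).
Proof.
move=> kF; rewrite lsum_cofree // big_ltn //; congr (_ + _).
  case: v => [|y v]; first by rewrite big_mkcond big_nat1.
  rewrite big_mkcond big_ltn //= add0r big_ltn //= take0 q01 drop0.
  rewrite [sdeg [:: y]]sdeg_cons sdeg_nil addr0.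
  rewrite big_nat big1 ?addr0 // => j /andP[j1 jv]; rewrite add0n; case: ifP => // _.
  rewrite lsum0 ?scaler0 // => w; apply: (kF [::]); apply: q0n.
  by rewrite size_take; case: ifP => /=; lia.
rewrite big_ltn // [X in _ + X]big_nat [X in _ + X]big1 ?addr0; last first.
  move=> i /andP[i1 iu]; apply: big1 => j _; rewrite lsum0 ?scaler0 // => w.
  by apply: (kF [::]); apply: q2n; rewrite size_takel.
by rewrite big_mkcond /= take0 drop0.
Qed.

(** [insert] with eps(g; h) evaluated to g{h} = q [:: g] h and id (x) h to h. *)
Fixpoint brace_insert (gs hs : word X) : seq (k * word X) :=
  match gs with
  | [::] => [:: (1, hs)]
  | g :: gs' => flatten [seq
      [seq ((-1) ^ (sdeg (take i hs) * sdeg gs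
                    + sdeg (take j (drop i hs)) * sdeg gs') * t.1,
            take i hs ++ q [:: g] (take j (drop i hs)) :: t.2)
      | t <- brace_insert gs' (drop (i + j) hs)]
    | i <- iota 0 (size hs).+1, j <- iota 0 (size hs - i).+1]
  end.

Lemma lsum_brace_insert n F g gs hs :
  lsum n F (brace_insert (g :: gs) hs)
  = \sum_(0 <= i < (size hs).+1) \sum_(0 <= j < (size hs - i).+1)
      (-1) ^ (sdeg (take i hs) * sdeg (g :: gs)
              + sdeg (take j (drop i hs)) * sdeg gs) *:
      lsum n (fun w => F (take i hs ++ q [:: g] (take j (drop i hs)) :: w))
        (brace_insert gs (drop (i + j) hs)).
Proof.
rewrite /lsum {1}/brace_insert -/brace_insert big_flatten big_allpairs_dep /index_iota !subn0.
apply: eq_bigr => i _; rewrite subn0; apply: eq_bigr => j _.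
by rewrite big_map scaler_sumr; apply: eq_bigr => t _; rewrite scalerA.
Qed.

(** [cofree_mul] emits factors one at a time, while [brace_insert] chooses together all the free
    letters before each [g]. [F] is generalised so that a factor already emitted can be absorbed
    into it. *)
Lemma cofree_brace_insert n F gs hs : kills_null F ->
  lsum n F (cofree_mul q gs hs) = lsum n F (brace_insert gs hs).
Proof.
elim: gs F hs => [|g gs IHg] F hs kF.
  by rewrite cofree_brace_nil // /lsum big_seq1 scale1r.
elim: hs F kF => [|y hs IHh] F kF; rewrite cofree_brace_cons // lsum_brace_insert.
  rewrite add0r !big_nat1 /= sdeg_nil mul0r mulr0 expr0z !scale1r.
  by rewrite IHg ?mul0r ?addr0 ?expr0z ?scale1r //; apply: kills_null_cons.
(* At [i = 0] the letter [g] takes its block immediately; for [i > 0] the letter [y] stays free and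
   the induction on [hs] applies. *)
rewrite [RHS]big_nat_recl // [LHS]addrC; congr (_ + _).
  rewrite subn0; apply: eq_bigr => j _; rewrite take0 drop0 sdeg_nil mul0r add0r.
  by rewrite mulrC add0n IHg //; apply: kills_null_cons.
rewrite (IHh _ (kills_null_cons _ kF)) lsum_brace_insert scaler_sumr.
apply: eq_bigr => i _; rewrite subSS scaler_sumr; apply: eq_bigr => j _ /=.
by rewrite scalerA -signD !sdeg_cons; congr ((-1) ^ _ *: _); lia.
Qed.

End Brace.

(** * The bar differential *)

Section Coder.
Variables (k : fieldType) (X Y : int -> lmodType k) (b : word X -> elt X).
Implicit Types (F : word X -> elt Y) (v : word X).

Lemma lsum_coder n F v :
  lsum n F (coder b v)
  = \sum_(0 <= i < size v) \sum_(0 <= j < size v - i)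
      (-1) ^ sdeg (take i v) *:
      hpart n (F (take i v ++ b (take j.+1 (drop i v)) :: drop (i + j.+1) v)).
Proof.
rewrite /lsum /coder big_allpairs_dep /index_iota !subn0.
by apply: eq_bigr => i _; rewrite subn0.
Qed.

(** A proper block leaves another letter beside its image, so only the block equal to the whole word
    contributes. *)
Lemma coder_linear_part n F v : kills_longer 1 F -> (0 < size v)%N ->
  lsum n F (coder b v) = hpart n (F [:: b v]).
Proof.
move=> F1; rewrite lsum_coder; case Ev: (size v) => [|s] // _.
rewrite big_ltn // subn0 big_nat_recr //= big_nat big1 ?add0r => [|j /andP[_ js]].
  rewrite big_nat big1 ?addr0 => [|i /andP[i0 iS]]; last first.
    rewrite big_nat; apply: big1 => j /andP[_ jS]; rewrite F1 ?scaler0 //.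
    rewrite size_cat /= size_takel; lia.
  by rewrite take0 drop0 sdeg_nil expr0z scale1r add0n take_oversize ?drop_oversize ?Ev.
by rewrite F1 ?scaler0 // size_cat /= size_drop Ev; lia.
Qed.

End Coder.

(** * Dg algebra operations on homogeneous elements, and the square of the bar differential *)

Section DgAlg.
Variables (k : fieldType) (A : dgAlg k).
Implicit Types x y z : elt A.

Lemma hpart_emulDl n i a (x x' : A i) y :
  hpart n (emul (el (a *: x + x')) y)
  = a *: hpart n (emul (el x) y) + hpart n (emul (el x') y).
Proof. by rewrite /emul /= dgM_linl hpartD. Qed.

Lemma hpart_emulDr n i a x (y y' : A i) :
  hpart n (emul x (el (a *: y + y')))
  = a *: hpart n (emul x (el y)) + hpart n (emul x (el y')).
Proof. by rewrite /emul /= dgM_linr hpartD. Qed.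

Lemma emul_nulll x y : null x -> null (emul x y).
Proof.
move=> /null_el0 -> n; have := hpart_emulDl n (-1) (0 : A (deg x)) 0 y.
by rewrite scaler0 addr0 scaleN1r addNr.
Qed.

Lemma emul_nullr x y : null y -> null (emul x y).
Proof.
move=> /null_el0 -> n; have := hpart_emulDr n (-1) x (0 : A (deg y)) 0.
by rewrite scaler0 addr0 scaleN1r addNr.
Qed.

Lemma hpart_emulZl n i a (x : A i) y :
  hpart n (emul (el (a *: x)) y) = a *: hpart n (emul (el x) y).
Proof.
have := hpart_emulDl n a x 0 y; rewrite addr0 => ->.
by rewrite [X in _ + X]emul_nulll ?addr0 //; apply: null0.
Qed.

Lemma hpart_emulZr n i a x (y : A i) :
  hpart n (emul x (el (a *: y))) = a *: hpart n (emul x (el y)).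
Proof.
have := hpart_emulDr n a x y 0; rewrite addr0 => ->.
by rewrite [X in _ + X]emul_nullr ?addr0 //; apply: null0.
Qed.

Lemma emulA x y z : emul x (emul y z) = emul (emul x y) z.
Proof. exact: dgM_assoc. Qed.

Lemma emul1l x : emul e1 x = x.
Proof. by rewrite /emul /= dgM_1l el_val. Qed.

Lemma emul1r x : emul x e1 = x.
Proof. by rewrite /emul /= dgM_1r el_val. Qed.

Lemma hpart_edD n i a (x x' : A i) :
  hpart n (ed (el (a *: x + x'))) = a *: hpart n (ed (el x)) + hpart n (ed (el x')).
Proof. by rewrite /ed /= dgD_lin hpartD. Qed.

Lemma ed_null x : null x -> null (ed x).
Proof.
move=> /null_el0 -> n; have := hpart_edD n (-1) (0 : A (deg x)) 0.
by rewrite scaler0 addr0 scaleN1r addNr.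
Qed.

Lemma hpart_edZ n i a (x : A i) :
  hpart n (ed (el (a *: x))) = a *: hpart n (ed (el x)).
Proof.
have := hpart_edD n a x 0; rewrite addr0 => ->.
by rewrite [X in _ + X]ed_null ?addr0 //; apply: null0.
Qed.

Lemma ed_ed_null x : null (ed (ed x)).
Proof. by rewrite /ed /= dgD_sq; apply: null0. Qed.

Lemma hpart_ed_emul n x y :
  hpart n (ed (emul x y))
  = hpart n (emul (ed x) y) + (-1) ^ deg x *: hpart n (emul x (ed y)).
Proof.
have [e|ne] := eqVneq n (deg x + deg y + 1).
  by rewrite e /ed /emul /= hpart_el dgD_leibniz.
rewrite !hpart_ne ?scaler0 ?addr0 //=; lia.
Qed.

Lemma bar_long (v : word A) : (2 < size v)%N -> null (bar v).
Proof. by case: v => [|x [|y [|z v]]] //= _; apply: null0. Qed.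

Lemma hpart_bar2 n x y :
  hpart n (bar [:: x; y]) = (-1) ^ deg x *: hpart n (emul x y).
Proof. exact: hpart_scale. Qed.

Lemma hpart_bar_bar2 n x y :
  hpart n (bar [:: bar [:: x; y]]) = (-1) ^ deg x *: hpart n (ed (emul x y)).
Proof. exact: hpart_edZ. Qed.

Lemma hpart_emul_bar2 n x y z :
  hpart n (emul (bar [:: x; y]) z) = (-1) ^ deg x *: hpart n (emul (emul x y) z).
Proof. exact: hpart_emulZl. Qed.

Lemma hpart_emul_bar2r n x y z :
  hpart n (emul x (bar [:: y; z])) = (-1) ^ deg y *: hpart n (emul x (emul y z)).
Proof. exact: hpart_emulZr. Qed.

Lemma bar_deg (v : word A) : deg (bar v) = sdeg v + 2.
Proof.
by case: v => [|x [|y [|z v]]] //=; rewrite !sdeg_cons sdeg_nil /=; lia.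
Qed.

Lemma bar_multilinear : multilinear (@bar k A).
Proof.
move=> n u j a x x' v; have [lt2|] := ltnP 2 (size u + (size v).+1).
  by rewrite !bar_long ?size_cat //= scaler0 addr0.
case: u => [|y [|z u]]; case: v => [|y' [|z' v]] le2; try by move: le2 => /=; lia.
- exact: hpart_edD.
- by rewrite !cat0s !hpart_bar2 hpart_emulDl scalerDr !scalerA mulrC.
- by rewrite !cat1s !hpart_bar2 hpart_emulDr scalerDr !scalerA mulrC.
Qed.

(** On words of length 1, 2 and 3 this is d^2 = 0, the Leibniz rule and associativity. *)
Lemma coder_bar n (v : word A) : lsum n (@bar k A) (coder (@bar k A) v) = 0.
Proof.
have kb := multilinear_kills_null bar_multilinear.
have [lt3|] := ltnP 3 (size v).
  rewrite lsum_coder big_nat big1 // => i /andP[_ iv].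
  (* With at least four letters, a block of one or two leaves at least three letters for the outer
     [bar]; a longer block is killed by the inner one. *)
  rewrite big_nat big1 // => j /andP[_ jv]; have [j2|j2] := ltnP j 2.
    by rewrite bar_long ?scaler0 // size_cat /= size_drop size_takel; lia.
  by rewrite kb ?scaler0 //; apply: bar_long; rewrite size_takel ?size_drop; lia.
case: v => [|x [|y [|z [|t v]]]] // _.
- by rewrite /lsum big_nil.
- by rewrite lsum_coder /= !big_nat1 /= ed_ed_null scaler0.
- have -> : coder (@bar k A) [:: x; y]
    = [:: ((-1) ^ sdeg ([::] : word A), [:: bar [:: x]; y]);
          ((-1) ^ sdeg ([::] : word A), [:: bar [:: x; y]]);
          ((-1) ^ sdeg [:: x], [:: x; bar [:: y]])] by [].
  rewrite !lsum_cons lsum_nil addr0.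
  rewrite sdeg_cons !sdeg_nil expr0z !scale1r addr0 hpart_bar_bar2 hpart_ed_emul.
  rewrite !hpart_bar2 /= scalerDr !scalerA.
  rewrite (@sign_eqN k 0 (deg x + 1) (deg x)) ?addr0 // scaleNr.
  rewrite -!signD. rewrite (@sign_eq k (deg x) (_ + _) 0); last by lia.
  rewrite (@sign_eqN k (deg x - 1) (_ - _ + _) 0); last by lia.
  by rewrite expr0z addrA addrA addNr add0r scaleN1r scale1r subrr.
have -> : coder (@bar k A) [:: x; y; z]
  = [:: ((-1) ^ sdeg ([::] : word A), [:: bar [:: x]; y; z]);
        ((-1) ^ sdeg ([::] : word A), [:: bar [:: x; y]; z]);
        ((-1) ^ sdeg ([::] : word A), [:: bar [:: x; y; z]]);
        ((-1) ^ sdeg [:: x], [:: x; bar [:: y]; z]);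
        ((-1) ^ sdeg [:: x], [:: x; bar [:: y; z]]);
        ((-1) ^ sdeg [:: x; y], [:: x; y; bar [:: z]])] by [].
rewrite !lsum_cons lsum_nil.
rewrite !sdeg_cons !sdeg_nil !addr0 !(@bar_long [:: _; _; _]) // !scaler0 !add0r.
rewrite [hpart n (bar [:: bar [:: x; y; z]])]ed_null; last exact: null0.
(* The survivors are (xy)z and x(yz), with opposite signs. *)
rewrite !hpart_bar2 hpart_emul_bar2 hpart_emul_bar2r emulA bar_deg.
rewrite !sdeg_cons sdeg_nil !scalerA scaler0 add0r addr0.
rewrite expr0z mul1r -!signD addr0 -scalerDl.
rewrite (@sign_eq k (deg x) (_ + _ + _) (deg y)); last by lia.
by rewrite (@sign_eqN k (deg x - 1) (_ - _ + _) (deg y)) ?subrr ?addrN ?scale0r //; lia.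
Qed.

End DgAlg.

(** * Braces and pairings *)

Section BraceBar.
Variables (k : fieldType) (A : dgAlg k) (q : word A -> word A -> elt A).
Hypothesis q01 : forall x, q [::] [:: x] = x.
Hypothesis q0n : forall v, size v != 1%N -> null (q [::] v).
Hypothesis q2n : forall u v, (1 < size u)%N -> null (q u v).
Hypothesis q1_deg : forall x v, deg (q [:: x] v) = deg x + sdeg v.

Let kb : kills_null (@bar k A) := multilinear_kills_null (@bar_multilinear k A).
Let bar_null1 (x : elt A) v : null x -> null (bar (x :: v)).
Proof. exact: (kb [::]). Qed.
Let bar_null2 (y x : elt A) : null x -> null (bar [:: y; x]).
Proof. exact: (kb [:: y] [::]). Qed.
Let b2 : kills_longer 2 (@bar k A) := @bar_long k A.

(** [bar] sees at most two factors. Of two factors, the one without [x] must be a single letter,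
    hence the first or the last letter of [y :: v]. *)
Lemma bar_cofree1 n x y v :
  lsum n (@bar k A) (cofree_mul q [:: x] (y :: v))
  = hpart n (ed (q [:: x] (y :: v)))
    + (- ((-1) ^ (deg x * (deg y - 1)) *: hpart n (emul y (q [:: x] v)))
       + (-1) ^ (deg x + sdeg (belast y v)) *:
           hpart n (emul (q [:: x] (belast y v)) (last y v))).
Proof.
rewrite cofree_quadratic_part //; congr (_ + _).
rewrite big_ltn // big_nat1; congr (_ + _).
  rewrite big_mkcond big_ltn //= add0r big_ltn //= take0 drop0 q01.
  rewrite big_nat big1 ?addr0 => [|j /andP[j1 jv]].
    rewrite (hpart_bar2 n y) scalerA -signD -scaleNr; congr (_ *: _).
    by apply: (@sign_eqN _ 0); rewrite !sdeg_cons sdeg_nil; lia.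
  rewrite add0n; case: ifP => // _; rewrite bar_null1 ?scaler0 //.
  by apply: q0n; rewrite size_takel /=; lia.
set B := belast y v; set L := last y v.
have sB : size B = size v by rewrite size_belast.
have Ev : y :: v = B ++ [:: L] by rewrite cats1 lastI.
rewrite big_mkcond big_nat_recr //= ltnn addr0 big_nat_recr //= ltnSn.
rewrite big_nat big1 ?add0r => [|j /andP[_ jv]].
  rewrite Ev -sB take_size_cat // drop_size_cat // q01 sdeg_nil mul0r expr0z scale1r.
  by rewrite (hpart_bar2 n _ L) q1_deg.
case: ifP => // _; rewrite bar_null2 ?scaler0 //.
by apply: q0n; rewrite size_drop /=; lia.
Qed.

(** A factor with both [x] and [y] is null, so exactly two factors occur, one for each letter; their
    products form the sum in the expansion of eps(xy; v). *)
Lemma bar_cofree2 n x y v :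
  lsum n (@bar k A) (cofree_mul q [:: x; y] v)
  = (-1) ^ deg x *: \sum_(0 <= m < (size v).+1) (-1) ^ (deg y * sdeg (take m v)) *:
        hpart n (emul (q [:: x] (take m v)) (q [:: y] (drop m v))).
Proof.
rewrite cofree_quadratic_part // bar_null1 ?add0r; last exact: q2n.
rewrite big_ltn // big1 ?add0r => [|j _]; last first.
  by rewrite bar_null2 ?scaler0 //; apply: q2n.
rewrite big_ltn // big_nat1 [X in _ + X]big1 ?addr0 => [|j _]; last first.
  by rewrite bar_null1 ?scaler0 //; apply: q2n.
rewrite big_mkcond scaler_sumr !big_nat; apply: eq_bigr => j /andP[_ jv].
rewrite ifT /=; last exact: jv.
rewrite (hpart_bar2 n (q _ _)) q1_deg !scalerA -!signD sdeg_cons sdeg_nil.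
congr (_ *: _); apply: (@sign_eq _ 0); lia.
Qed.

(** Three left letters distributed over at most two factors put two of them in the same factor,
    which is then null. *)
Lemma bar_cofree_long n u v : (2 < size u)%N ->
  lsum n (@bar k A) (cofree_mul q u v) = 0.
Proof.
move=> u2; rewrite cofree_quadratic_part //; last by lia.
rewrite bar_null1 ?add0r; last by apply: q2n; lia.
rewrite big_nat big1 // => i /andP[_ iu]; apply: big1 => j _.
have [i2|i2] := ltnP 1 i.
  by rewrite bar_null1 ?scaler0 //; apply: q2n; rewrite size_takel; lia.
by rewrite bar_null2 ?scaler0 //; apply: q2n; rewrite size_drop; lia.
Qed.

Lemma coder_brace1 n u v : (0 < size u)%N ->
  lsum n (q^~ v) (coder (@bar k A) u) = hpart n (q [:: bar u] v).
Proof. by move=> u0; rewrite coder_linear_part // => w; apply: q2n. Qed.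

End BraceBar.

(** * From a pairing to a brace algebra *)

Section PairingToBrace.
Variables (k : fieldType) (A : dgAlg k) (P : pairing A A A).
Hypothesis PL : forall f, emap (pL P) f = f.
Hypothesis PR : forall f, emap (pR P) f = f.

(** The default is the zero of the degree demanded by [Binf_q_deg]. *)
Definition brace_of_pairing (u v : word A) : elt A :=
  match u, v with
  | [:: x], _ => pE P x v
  | [::], [:: y] => y
  | _, _ => el (0 : A (sdeg u + sdeg v + 1))
  end.
Local Notation q := brace_of_pairing.

Hypothesis PA : forall n f gs hs,
  hpart n (pE P (pE P f gs) hs) = lsum n (pE P f) (brace_insert q gs hs).

Let q01 x : q [::] [:: x] = x. Proof. by []. Qed.

Let q0n v : size v != 1%N -> null (q [::] v).
Proof. by case: v => [|y [|z v]] //= _; apply: null0. Qed.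

Let q2n u v : (1 < size u)%N -> null (q u v).
Proof. by case: u => [|x [|y u]] //= _; apply: null0. Qed.

Let q_linl w : multilinear (q^~ w).
Proof.
move=> n u j a x x' v; have [lt1|] := ltnP 1 (size u + (size v).+1).
  by rewrite !q2n ?size_cat //= scaler0 addr0.
case: u => [|y u]; case: v => [|z v] /= le1; try by lia.
exact: pE_linl.
Qed.

Let q_linr w : multilinear (q w).
Proof.
case: w => [|y [|z w]] n u j a x x' v; last by rewrite !q2n ?scaler0 ?addr0.
  have [e|ne] := eqVneq (size u + (size v).+1)%N 1%N.
    case: u e => [|y u]; case: v => [|z v] /= e; try by lia.
    exact: hpartD.
  by rewrite !q0n ?size_cat //= scaler0 addr0.
exact: pE_linr.
Qed.

Lemma brace_of_pairing_Br : is_Br (@bar k A) q.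
Proof.
split; last by move=> n u v u1; apply: q2n.
split.
- exact: bar_deg.
- exact: bar_multilinear.
- by move=> n; apply: null0.
- case=> [|x [|y u]] [|z [|t v]]; rewrite /= ?pE_deg ?sdeg_cons ?sdeg_nil //=; lia.
- by move=> n u j a x x' v w; apply: q_linl.
- by move=> n w u j a x x' v; apply: q_linr.
- exact: q01.
- by move=> x; rewrite /= pE_nil PL.
- by move=> n v v1; apply: q0n.
- by move=> n [|x [|y u]] //= _; apply: null0.
- exact: coder_bar.
(* Leibniz identity by the number of letters of [u]: for none both sides are b(v), for one it is
   [pE_d], for two it is [pE_mul], and beyond that both sides vanish. *)
- move=> n u v; have q1_deg x w : deg (q [:: x] w) = deg x + sdeg w by exact: pE_deg.
  case: u => [|x [|y [|z u]]].
  + rewrite cofree_brace_nil //; last exact: multilinear_kills_null (@bar_multilinear k A).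
    rewrite lsum_nil add0r sdeg_nil expr0z scale1r; case: v => [|y v].
      by rewrite lsum_nil; apply: null0.
    by rewrite coder_linear_part // => w w1; apply: q0n; lia.
  + rewrite coder_brace1 //; case: v => [|y v].
      rewrite cofree_brace_cons //; last exact: multilinear_kills_null (@bar_multilinear k A).
      rewrite add0r big_nat1 /= sdeg_nil mul0r expr0z scale1r !lsum_nil scaler0 addr0.
      by rewrite lsum_cons lsum_nil addr0 scale1r /= !pE_nil !PL.
    rewrite bar_cofree1 //= pE_d !PR sdeg_cons sdeg_nil addr0.
    rewrite (@sign_eqN _ (-1) (deg x - 1) (deg x)); last by lia.
    by rewrite scaleNr addrACA addrK addNr addr0.
  + rewrite coder_brace1 // bar_cofree2 // [X in _ + _ *: X]lsum0 ?scaler0 ?addr0.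
      rewrite (multilinear_scale n (q_linl v) [::] [::] _ (val_el (emul x y))).
      by rewrite /= pE_mul.
    by move=> w; apply: q2n.
  + rewrite coder_brace1 // bar_cofree_long // [X in _ + _ *: X]lsum0 ?scaler0 ?addr0.
      rewrite (multilinear_kills_null (q_linl v) [::]) //.
      exact: bar_long.
    by move=> w; apply: q2n.
(* Associativity: for [u] empty both sides are q(v, w), for one letter it is the brace relation
   [PA], and otherwise both sides vanish. *)
- move=> n u v w; case: u => [|x [|y u]].
  + rewrite cofree_brace_nil //; last exact: multilinear_kills_null.
    have [/eqP|vw] := posnP (size v + size w).
      by rewrite addn_eq0 !size_eq0 => /andP[/eqP-> /eqP->];
        rewrite lsum_cons lsum_nil addr0 scale1r.
    by rewrite cofree_linear_part // => t t1; apply: q0n; lia.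
  + rewrite cofree_linear_part // => [|t]; last exact: q2n.
    rewrite cofree_brace_insert //; first exact: PA.
    exact: multilinear_kills_null.
  + rewrite cofree_linear_part // => [|t]; last exact: q2n.
    rewrite (multilinear_kills_null (q_linl w) [::]) ?lsum0 // => t; exact: q2n.
Qed.

End PairingToBrace.

(** * From a brace algebra to a pairing *)

Section BraceToPairing.
Variables (k : fieldType) (A : dgAlg k) (q : word A -> word A -> elt A).
Hypothesis Br : is_Br (@bar k A) q.
Hypothesis unit_r : braces_share_unit q.

Let Binf : is_Binf (@bar k A) q := Br.1.
Let q01 x : q [::] [:: x] = x. Proof. exact: Binf_q01 Binf x. Qed.
Let q0n v : size v != 1%N -> null (q [::] v).
Proof. by move=> v1 n; apply: (Binf_q0n Binf). Qed.
Let q2n u v : (1 < size u)%N -> null (q u v).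
Proof. by move=> u1 n; apply: Br.2. Qed.
Let q1_deg x v : deg (q [:: x] v) = deg x + sdeg v.
Proof. rewrite (Binf_q_deg Binf) sdeg_cons sdeg_nil; lia. Qed.
Let q_linl w : multilinear (q^~ w).
Proof. by move=> n u j a x x' v; apply: (Binf_q_linl Binf). Qed.
Let q_linr w : multilinear (q w).
Proof. by move=> n u j a x x' v; apply: (Binf_q_linr Binf). Qed.

Lemma brace_mul n x y v :
  hpart n (q [:: emul x y] v)
  = \sum_(0 <= m < (size v).+1) (-1) ^ (deg y * sdeg (take m v)) *:
      hpart n (emul (q [:: x] (take m v)) (q [:: y] (drop m v))).
Proof.
have s0 : (-1) ^ deg x != 0 :> k by rewrite expfz_neq0 // oppr_eq0 oner_eq0.
(* Both sides of the Leibniz identity at [[:: x; y]] carry the sign (-1)^|x| of [bar], which is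
   invertible and cancels. *)
apply: (scalerI s0); rewrite -bar_cofree2 // (Binf_leibniz Binf) coder_brace1 //.
rewrite [X in _ = _ + _ *: X]lsum0 ?scaler0 ?addr0 => [|w]; last exact: q2n.
by rewrite (multilinear_scale n (q_linl v) [::] [::] _ (val_el (emul x y))).
Qed.

Lemma brace_d n x y v :
  hpart n (ed (q [:: x] (y :: v)))
  = hpart n (q [:: ed x] (y :: v))
    - (-1) ^ deg x *: lsum n (q [:: x]) (coder (@bar k A) (y :: v))
    + (-1) ^ (deg x * (deg y - 1)) *: hpart n (emul y (q [:: x] v))
    - (-1) ^ (deg x + sdeg (belast y v)) *:
        hpart n (emul (q [:: x] (belast y v)) (last y v)).
Proof.
have := Binf_leibniz Binf n [:: x] (y :: v).
rewrite bar_cofree1 // coder_brace1 // sdeg_cons sdeg_nil addr0.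
rewrite (@sign_eqN _ (-1) (deg x - 1) (deg x)); last by lia.
by rewrite scaleNr => <-; rewrite -[RHS]addrA -[RHS]addrA addrACA addNr subrr !addr0.
Qed.

(** Expanding (1 1){v} gives 1{v} = 1{v} + 1{v} + products of 1{v'}1{v''} with
    v', v'' shorter than v. *)
Lemma brace_unit_l n v : (0 < size v)%N -> hpart n (q [:: e1] v) = 0.
Proof.
have [s] := ubnP (size v); elim: s v n => // s IH v n vs v0.
have := brace_mul n e1 e1 v; rewrite emul1l.
rewrite big_nat_recr //= big_ltn // take0 drop0 take_size drop_size.
rewrite !(Binf_q10 Binf) emul1l emul1r mul0r expr0z !scale1r big_nat big1.
  by rewrite addr0 mul0r expr0z scale1r -{1}[hpart n _]addr0 => /addrI.
move=> i /andP[i0 iv]; rewrite emul_nulll ?scaler0 // => m.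
by rewrite IH // size_takel; lia.
Qed.

Lemma emap_id_hom (x : elt A) : emap (id_hom A) x = x.
Proof. exact: el_val. Qed.

(** [unit_r] supplies [pE_1r] alone; all other fields follow from [Br]. The definition is
    transparent so that [pE] computes to the brace. *)
Definition pairing_of_brace : pairing A A A.
Proof.
apply: (@Pairing k A A A (id_hom A) (id_hom A) (fun x => q [:: x])).
- exact: q1_deg.
- by move=> n i a f f' v; apply: (q_linl v n [::]).
- by move=> n f; apply: q_linr.
- by move=> f; rewrite (Binf_q10 Binf) emap_id_hom.
- exact: brace_unit_l.
- by move=> n f u v; apply: unit_r.
- exact: brace_mul.
- by move=> n f y v; rewrite brace_d !emap_id_hom.
Defined.

Lemma brace_assoc n f gs hs :
  hpart n (q [:: q [:: f] gs] hs) = lsum n (q [:: f]) (brace_insert q gs hs).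
Proof.
have := Binf_assoc Binf n [:: f] gs hs.
rewrite cofree_linear_part // => [->|t]; last exact: q2n.
by rewrite cofree_brace_insert //; apply: multilinear_kills_null.
Qed.

End BraceToPairing.

(** * Generators of the twisted tensor product *)

Section Generation.
Variable k : fieldType.

Lemma pE_0l (C D E : dgAlg k) (P : pairing C D E) n i v :
  hpart n (pE P (el (0 : C i)) v) = 0.
Proof.
have := pE_linl P n (-1) (0 : C i) 0 v.
by rewrite scaler0 addr0 scaleN1r addNr.
Qed.

Section Term.
Variables (C D : dgAlg k).

Lemma cls_rep i (x : twt C D i) : cls (rep x) = x.
Proof. exact: reprK. Qed.

Lemma lift_cls E (P : pairing C D E) i (t : term C D i) :
  Defs.lift P _ (cls t) = eval P t.
Proof. exact: evq_cls. Qed.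

Lemma cls_T0 i : cls (@T0 k C D i) = 0 :> twt C D i.
Proof. by []. Qed.

Lemma cls_add i (s t : term C D i) : cls (TAdd s t) = (cls s + cls t : twt C D i).
Proof.
by apply: twt_ext => E P; rewrite hom_add !lift_cls.
Qed.

Lemma cls_scale i a (t : term C D i) : cls (TScale a t) = (a *: cls t : twt C D i).
Proof.
by apply: twt_ext => E P; rewrite hom_scale !lift_cls.
Qed.

Lemma cls_mul i j (s : term C D i) (t : term C D j) :
  cls (TMul s t) = dgM (cls s : twt C D i) (cls t : twt C D j) :> twt C D _.
Proof.
by apply: twt_ext => E P; rewrite hom_M !lift_cls.
Qed.

Lemma cls_diff i (t : term C D i) :
  cls (TDiff t) = dgD (cls t : twt C D i) :> twt C D _.
Proof.
by apply: twt_ext => E P; rewrite hom_D !lift_cls.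
Qed.

(** Every element is the class of a formal expression, so induction on that expression reduces
    equality to the generators. *)
Lemma tw_hom_ext (E : dgAlg k) (phi psi : dgHom (twt C D) E) :
  (forall f, emap phi (emap (inl C D) f) = emap psi (emap (inl C D) f)) ->
  (forall g, emap phi (emap (inr C D) g) = emap psi (emap (inr C D) g)) ->
  (forall f v, emap phi (eps f v) = emap psi (eps f v)) ->
  forall i (x : twt C D i), phi i x = psi i x.
Proof.
move=> Hl Hr He i x; rewrite -(cls_rep x).
elim: (rep x) => {i x} [i|i s IHs t IHt|i a t IHt||i j s IHs t IHt|i t IHt|i f|i g|f v].
- by rewrite cls_T0 !hom_0.
- by rewrite cls_add !hom_add IHs IHt.
- by rewrite cls_scale !hom_scale IHt.
- exact: (etrans (hom_1 phi) (esym (hom_1 psi))).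
- by rewrite cls_mul !hom_M IHs IHt.
- by rewrite cls_diff !hom_D IHt.
- exact/el_inj/(Hl (el f)).
- exact/el_inj/(Hr (el g)).
- exact/el_inj/He.
Qed.

(** The left arguments on which [P] and [Q] agree for all [hs] are closed under the term
    constructors: products by [pE_mul], differentials by solving [pE_d] for the term in d f. *)
Lemma pairing_ext (E F : dgAlg k) (P Q : pairing (twt C D) E F) :
  (forall f, emap (pL P) f = emap (pL Q) f) ->
  (forall h, emap (pR P) h = emap (pR Q) h) ->
  (forall f hs, pE P (emap (inl C D) f) hs = pE Q (emap (inl C D) f) hs) ->
  (forall g hs, pE P (emap (inr C D) g) hs = pE Q (emap (inr C D) g) hs) ->
  (forall f gs hs, pE P (eps f gs) hs = pE Q (eps f gs) hs) ->
  forall f hs, pE P f hs = pE Q f hs.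
Proof.
move=> HL HR Hl Hr He [i x] hs; rewrite -[existT _ _ _]/(el x) -(cls_rep x).
elim: (rep x) hs => {i x} [i|i s IHs t IHt|i a t IHt||i j s IHs t IHt|i t IHt|i f|i g|f v] hs.
- apply: elt_ext => [|n]; first by rewrite !pE_deg.
  by rewrite cls_T0 !pE_0l.
- apply: elt_ext => [|n]; first by rewrite !pE_deg.
  by rewrite cls_add -[cls s]scale1r !pE_linl IHs IHt.
- apply: elt_ext => [|n]; first by rewrite !pE_deg.
  by rewrite cls_scale -[_ *: _]addr0 !pE_linl !pE_0l IHt.
- case: hs => [|h hs]; first by rewrite !pE_nil.
  by apply: elt_ext => [|n]; rewrite ?pE_deg // !(pE_1l _ n).
- apply: elt_ext => [|n]; first by rewrite !pE_deg.
  rewrite cls_mul -[el _]/(emul (el _) (el _)) !pE_mul.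
  by apply: eq_bigr => m _; rewrite IHs IHt.
- case: hs => [|h hs]; first by rewrite !pE_nil.
  apply: elt_ext => [|n]; first by rewrite !pE_deg.
  rewrite cls_diff -[el _]/(ed (el _)).
  (* Differentiating the known equality for [t]: by [pE_d] all terms but the one in d t agree
     already and cancel. *)
  have /(congr1 (fun y => hpart n (ed y))) := IHt (h :: hs).
  rewrite !pE_d HR (IHt hs) HR (IHt (belast h hs)).
  rewrite (@eq_lsum _ _ _ n (pE P (el (cls t))) (pE Q (el (cls t)))) => [|w]; last by rewrite IHt.
  by move=> /addIr /addIr /addIr.
- exact: (Hl (el f)).
- exact: (Hr (el g)).
- exact: He.
Qed.

End Term.

(** Applied to [univ], it records a dg algebra map by its values on generators, so that
    [pairing_ext] can compare two such maps. *)
Definition pushforward (C D E E' : dgAlg k) (phi : dgHom E E') (P : pairing C D E) :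
  pairing C D E'.
Proof.
apply: (@Pairing k C D E' (comp_hom phi (pL P)) (comp_hom phi (pR P))
  (fun f v => emap phi (pE P f v))).
- by move=> f v; rewrite -(pE_deg P).
- by move=> n i a f f' v; rewrite -!hom_hpart pE_linl hom_lin.
- by move=> n f u j a g g' v; rewrite -!hom_hpart pE_linr hom_lin.
- by move=> f; rewrite pE_nil.
- by move=> n v v0; rewrite -hom_hpart pE_1l ?hom_0.
- by move=> n f u v; rewrite -hom_hpart pE_1r hom_0.
- move=> n f2 f1 v; rewrite -hom_hpart pE_mul hom_sum; apply: eq_bigr => m _.
  by rewrite hom_scale hom_hpart emap_mul.
- move=> n f y v; rewrite -emap_d -hom_hpart pE_d.
  rewrite !(hom_add, hom_opp, hom_scale, hom_hpart, hom_sum) !emap_mul.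
  congr (_ - _ *: _ + _ - _).
  by apply: eq_bigr => t _; rewrite hom_scale hom_hpart.
Defined.

(** Two reductions: [tw_hom_ext] handles the outer left factor, and [pairing_ext] reduces eps(f; hs)
    with f arbitrary in the inner product to f a generator. *)
Lemma tw3_hom_ext (C D E F : dgAlg k) (phi psi : dgHom (twt (twt C D) E) F) :
  (forall f, emap phi (emap (inl _ E) (emap (inl C D) f))
           = emap psi (emap (inl _ E) (emap (inl C D) f))) ->
  (forall g, emap phi (emap (inl _ E) (emap (inr C D) g))
           = emap psi (emap (inl _ E) (emap (inr C D) g))) ->
  (forall f gs, emap phi (emap (inl _ E) (eps f gs))
              = emap psi (emap (inl _ E) (eps f gs))) ->
  (forall h, emap phi (emap (inr _ E) h) = emap psi (emap (inr _ E) h)) ->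
  (forall f hs, emap phi (eps (emap (inl C D) f) hs)
              = emap psi (eps (emap (inl C D) f) hs)) ->
  (forall g hs, emap phi (eps (emap (inr C D) g) hs)
              = emap psi (eps (emap (inr C D) g) hs)) ->
  (forall f gs hs, emap phi (eps (eps f gs) hs) = emap psi (eps (eps f gs) hs)) ->
  forall i (x : twt (twt C D) E i), phi i x = psi i x.
Proof.
move=> Hll Hlr Hle Hr Hel Her Hee.
have Hl f : emap phi (emap (inl _ E) f) = emap psi (emap (inl _ E) f).
  case: f => i x; congr el.
  exact: (@tw_hom_ext _ _ _ (comp_hom phi (inl _ E)) (comp_hom psi (inl _ E))).
apply: tw_hom_ext => // f hs.
exact: (@pairing_ext _ _ _ _ (pushforward phi (univ _ E)) (pushforward psi (univ _ E))).
Qed.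

End Generation.

(** * Monoids *)

Section Monoid.
Variables (k : fieldType) (B : dgAlg k) (m : dgHom (twt B B) B).
Variable alpha : dgHom (twt (twt B B) B) (twt B (twt B B)).
Hypothesis alphaP : is_associator alpha.
Hypothesis m_inr : forall b, emap m (emap (inr B B) b) = b.
Variable q : word B -> word B -> elt B.
Hypothesis m_eps : forall f v, emap m (eps f v) = q [:: f] v.

(** [m] sends eps(g; h) to g{h} and id (x) h to h, and the signs in both sums depend on the same
    degrees. *)
Lemma map_insert gs hs :
  [seq (t.1, map (emap m) t.2) | t <- insert gs hs] = brace_insert q gs hs.
Proof.
elim: gs hs => [|g gs IH] hs.
  by rewrite /= -map_comp (eq_map (g := id)) ?map_id.
rewrite {1}/insert {1}/brace_insert map_flatten map_allpairs.
apply: (congr1 flatten); apply: (congr1 flatten); apply: eq_map => i.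
apply: eq_map => j; rewrite -/(insert gs _) -/(brace_insert q gs _).
rewrite -IH -!map_comp; apply: eq_map => t /=.
by rewrite map_cat /= -map_comp m_eps (eq_map (g := id)) ?map_id.
Qed.

(** Evaluates the composite through [alpha] in the monoid axiom on the only nontrivial
    generators. *)
Lemma assoc_eps_eps n f gs hs :
  hpart n (emap m (emap (tw_map (id_hom B) m) (emap alpha (eps (eps f gs) hs))))
  = lsum n (q [:: f]) (brace_insert q gs hs).
Proof.
rewrite -hom_hpart -hom_hpart (assoc_epseps alphaP) /lsum !hom_sum -map_insert big_map.
apply: eq_bigr => t _; rewrite !hom_scale !hom_hpart.
by rewrite tw_map_eps m_eps emap_id_hom.
Qed.

(** Evaluates the other composite, giving the iterated brace. *)
Lemma eps_eps f gs hs :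
  emap m (emap (tw_map m (id_hom B)) (eps (eps f gs) hs)) = q [:: q [:: f] gs] hs.
Proof.
by rewrite tw_map_eps !m_eps (eq_map (g := id)) ?map_id // => x; apply: emap_id_hom.
Qed.

End Monoid.

Section Generators.
Variable k : fieldType.

Lemma emap_comp (A B C : dgAlg k) (g : dgHom B C) (f : dgHom A B) x :
  emap (comp_hom g f) x = emap g (emap f x).
Proof. by []. Qed.

Lemma emap_tw_map_inl (C C' D D' : dgAlg k) (phi : dgHom C C') (psi : dgHom D D') f :
  emap (tw_map phi psi) (emap (inl C D) f) = emap (inl C' D') (emap phi f).
Proof. by apply: (congr1 el); apply: tw_map_inl. Qed.

Lemma emap_tw_map_inr (C C' D D' : dgAlg k) (phi : dgHom C C') (psi : dgHom D D') g :
  emap (tw_map phi psi) (emap (inr C D) g) = emap (inr C' D') (emap psi g).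
Proof. by apply: (congr1 el); apply: tw_map_inr. Qed.

Lemma emap_lift_inl (C D E : dgAlg k) (P : pairing C D E) f :
  emap (Defs.lift P) (emap (inl C D) f) = emap (pL P) f.
Proof. by apply: (congr1 el); apply: lift_inl. Qed.

Lemma emap_lift_inr (C D E : dgAlg k) (P : pairing C D E) g :
  emap (Defs.lift P) (emap (inr C D) g) = emap (pR P) g.
Proof. by apply: (congr1 el); apply: lift_inr. Qed.

Variables (C D E : dgAlg k) (alpha : dgHom (twt (twt C D) E) (twt C (twt D E))).
Hypothesis alphaP : is_associator alpha.

Lemma emap_assoc_inll f :
  emap alpha (emap (inl _ E) (emap (inl C D) f)) = emap (inl C _) f.
Proof. by apply: (congr1 el); apply: (assoc_inll alphaP). Qed.

Lemma emap_assoc_inlr g :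
  emap alpha (emap (inl _ E) (emap (inr C D) g)) = emap (inr C _) (emap (inl D E) g).
Proof. by apply: (congr1 el); apply: (assoc_inlr alphaP). Qed.

Lemma emap_assoc_inr h :
  emap alpha (emap (inr (twt C D) E) h) = emap (inr C _) (emap (inr D E) h).
Proof. by apply: (congr1 el); apply: (assoc_inr alphaP). Qed.

End Generators.

Theorem lemma1p2 (k : fieldType) (B : dgAlg k)
    (alpha : dgHom (twt (twt B B) B) (twt B (twt B B)))
    (alphaP : is_associator alpha) :
  (exists m : dgHom (twt B B) B, is_tw_monoid alpha m)
  <->
  (exists (b : word B -> elt B) (q : word B -> word B -> elt B),
     [/\ is_Br b q, (forall v, b v = bar v) & braces_share_unit q]).
Proof.
have id_map (v : word B) : map (emap (id_hom B)) v = v.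
  by rewrite (eq_map (g := id)) ?map_id // => x; apply: emap_id_hom.
split=> [[m [mA m1l m1r]]|[b [q [Br bE unit_r]]]].
  (* The braces are x{v} = m(eps(x; v)). *)
  set P := pushforward m (univ B B); set q := brace_of_pairing P.
  have m_inl f : emap m (emap (inl B B) f) = f.
    by case: f => i x; apply: (congr1 el); apply: m1r.
  have m_inr f : emap m (emap (inr B B) f) = f.
    by case: f => i x; apply: (congr1 el); apply: m1l.
  have m_eps f v : emap m (eps f v) = q [:: f] v by [].
  exists (@bar k B), q; split=> // [|n x u v]; last exact: pE_1r.
  apply: brace_of_pairing_Br => // n f gs hs.
  (* The hypothesis [PA] is the associativity of [m] read on eps(eps(f; gs); hs). *)
  rewrite -(assoc_eps_eps alphaP m_inr m_eps) -[pE _ _ _](eps_eps m_eps).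
  by congr hpart; apply: (congr1 el); apply: mA.
have eb : b = @bar k B by apply: funext.
rewrite {b}eb in Br bE.
set m := Defs.lift (pairing_of_brace Br unit_r); exists m.
have m_inl f : emap m (emap (inl B B) f) = f by rewrite emap_lift_inl; apply: emap_id_hom.
have m_inr f : emap m (emap (inr B B) f) = f by rewrite emap_lift_inr; apply: emap_id_hom.
have m_eps f v : emap m (eps f v) = q [:: f] v by rewrite lift_eps.
split=> [||].
(* Seven families of generators: six follow because [m] is the identity on both factors. *)
- apply: (@tw3_hom_ext _ _ _ _ _ (comp_hom m (tw_map m (id_hom B)))
    (comp_hom (comp_hom m (tw_map (id_hom B) m)) alpha)) => [f|g|f gs|h|f hs|g hs|f gs hs];
    rewrite !emap_comp.
  + by rewrite emap_assoc_inll // !emap_tw_map_inl emap_id_hom !m_inl.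
  + by rewrite emap_assoc_inlr // emap_tw_map_inr emap_tw_map_inl !m_inl !m_inr.
  + rewrite (assoc_eps alphaP) emap_tw_map_inl tw_map_eps m_inl -map_comp.
    by rewrite emap_id_hom (eq_map (g := id)) ?map_id.
  + by rewrite emap_assoc_inr // !emap_tw_map_inr emap_id_hom !m_inr.
  + rewrite (assoc_epsl alphaP) !tw_map_eps m_inl id_map emap_id_hom -map_comp.
    by rewrite (eq_map (g := id)) ?map_id.
  + by rewrite (assoc_epsr alphaP) tw_map_eps emap_tw_map_inr m_inr id_map m_inr.
  (* The seventh family is the brace relation. *)
  + apply: elt_ext => [|n] //.
    by rewrite (assoc_eps_eps alphaP m_inr m_eps) (eps_eps m_eps) brace_assoc.
- by move=> i x; apply: lift_inr.
- by move=> i x; apply: lift_inl.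
Qed.
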